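(* For any $0<\gamma\le\alpha\le1$, the probability measure $\mathrm{AG}^n_{\alpha,\gamma}$ converges weakly to $\mathrm{AG}^\infty_{\alpha,\gamma}$ as $n\to\infty$ with respect to the local limit topology.
   Context: Trees are rooted, unordered, with finite numbers of children, identified up to root- and parent-preserving bijections. For an integer $R\ge0$, $t|_R$ is the subtree of vertices at graph distance at most $R$ from the root; the local limit topology is induced by $d_{\mathrm{loc}}(t,s)=\exp[-\inf\{R\ge0:t|_R\ne s|_R\}]$. $c_u(t)$ is the number of children of $u$ in $t$; leaves are vertices without children. $\alpha$-$\gamma$ model ($0\le\gamma\le\alpha\le1$). $T_1$ is the single-vertex tree and $T_2$ the tree with two leaves attached to the root. For $n\ge3$, given $T_{n-1}$, view it as planted (a phantom edge is attached under the root), assign weight $1-\alpha$ to each edge ending at a leaf, $\gamma$ to each other edge (including the phantom edge), and $[c_u(T_{n-1})-1]\alpha-\gamma$ to each non-leaf vertex $u$. Pick an edge or vertex with probability proportional to the weights. If an edge was picked, place a new vertex in its middle and attach a new leaf to it; if a vertex was picked, attach a new leaf to it. The result is $T_n$ (with $n$ leaves), and $\mathrm{AG}^n_{\alpha,\gamma}$ is its law. Beta geometric law with parameters $(\theta,1-\theta)$, $\theta\in(0,1)$: $\mathbb P[X=n]=\frac{\theta\,\Gamma(n+1-\theta)}{\Gamma(1-\theta)\,(n+1)!}$ for $n\ge0$; if $\theta=1$, $X=0$ a.s. Infinite tree. For $0<\gamma\le\alpha\le1$ let $(X_n)_{n\ge0}$ be i.i.d. beta geometric with parameters $(\gamma/\alpha,1-\gamma/\alpha)$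 and, independently, $(Y_{n,k},\tau_{n,k})_{n,k\ge0}$ i.i.d. such that $Y_{n,k}$ is beta geometric with parameters $(\alpha,1-\alpha)$ and given $Y_{n,k}=\ell$, $\tau_{n,k}\sim\mathrm{AG}^{\ell+1}_{\alpha,\gamma}$. $\mathrm{AG}^\infty_{\alpha,\gamma}$ is the law of the tree obtained from an infinite branch $v_0$ (root)$,v_1,v_2,\dots$ by attaching, for each $n\ge0$, the roots of $\tau_{n,0},\dots,\tau_{n,X_n}$ by edges to $v_n$. *)

(* Defs.v *)
From HB Require Import structures.
From mathcomp Require Import all_boot all_order all_algebra finmap generic_quotient.
From mathcomp Require Import all_classical all_reals all_analysis.
From mathcomp Require Import ring lra zify.

Set Implicit Arguments.
Unset Strict Implicit.
Unset Printing Implicit Defensive.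

Import Order.TTheory GRing.Theory Num.Theory.
Import numFieldNormedType.Exports.

Local Open Scope classical_set_scope.
Local Open Scope quotient_scope.
Local Open Scope ring_scope.

(** * Locally finite rooted trees and the local topology *)

(* A rooted tree with finite numbers of children is encoded as a prefix-closed
   set of words: the root is the empty word and the parent of [rcons u i] is
   [u]; the labels [i] carry no meaning once trees are identified up to
   isomorphism. *)
Record rtree := RTree {
  vertex : set (seq nat) ;
  vertex_root : vertex [::] ;
  vertex_parent : forall u i, vertex (rcons u i) -> vertex u ;
  finite_children : forall u, finite_set [set i | vertex (rcons u i)] }.

(* [parent [::] = [::]], so that the condition on [parent] in [tree_iso] is
   void at the root once the root is preserved. *)
Definition parent (u : seq nat) : seq nat := take (size u).-1 u.

Definition tree_iso (t s : rtree) : Prop :=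
  exists f : seq nat -> seq nat,
    [/\ set_bij (vertex t) (vertex s) f, f [::] = [::]
      & forall u, vertex t u -> f (parent u) = parent (f u)].

Lemma parent_rcons u i : parent (rcons u i) = u.
Proof. by rewrite /parent size_rcons -cats1 take_size_cat. Qed.

Lemma size_parent u : size (parent u) = (size u).-1.
Proof. by rewrite /parent size_take; case: (size u) => //= n; rewrite ltnSn. Qed.

Lemma rtree_eq (t s : rtree) : vertex t = vertex s -> t = s.
Proof.
case: t s => [t t1 t2 t3] [s s1 s2 s3] /= ts; subst s.
by congr RTree; exact: Prop_irrelevance.
Qed.

Lemma rtree_parent (t : rtree) u : vertex t u -> vertex t (parent u).
Proof.
by elim/last_ind: u => [//|u i _] tu; rewrite parent_rcons; apply: vertex_parent tu.
Qed.

Lemma tree_iso_refl t : tree_iso t t.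
Proof. by exists id; split => //; split => // u tu; exists u. Qed.

Lemma tree_iso_sym t s : tree_iso t s -> tree_iso s t.
Proof.
move=> [f [fbij f0 fp]]; have [ff finj fsurj] := fbij.
have {}finj u v : vertex t u -> vertex t v -> f u = f v -> u = v.
  by move=> tu tv; apply: finj; rewrite inE.
have : forall v, exists u, vertex s v -> vertex t u /\ f u = v.
  move=> v; have [sv|nsv] := pselect (vertex s v); last by exists [::].
  by have [u tu fu] := fsurj _ sv; exists u.
move=> /choice[g gP].
have gK u : vertex t u -> g (f u) = u.
  move=> tu; have [tg fg] := gP _ (ff _ tu).
  exact: finj fg.
exists g; split.
- split.
  + by move=> v /gP[].
  + by move=> v w /[!inE] /gP[_ fv] /gP[_ fw] e; rewrite -fv -fw e.
  + by move=> u tu; exists (f u); [exact: ff|exact: gK].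
- by rewrite -{1}f0 gK//; exact: vertex_root.
- move=> v /gP[tg fg].
  by rewrite -{1}fg -fp// gK//; exact: rtree_parent.
Qed.

Lemma tree_iso_trans t s r : tree_iso t s -> tree_iso s r -> tree_iso t r.
Proof.
move=> [f [fbij f0 fp]] [g [gbij g0 gp]]; exists (g \o f); split.
- exact: set_bij_comp fbij gbij.
- by rewrite /= f0.
- move=> u tu /=; rewrite fp// gp//.
  by case: fbij => ff _ _; exact: ff.
Qed.

HB.instance Definition _ := gen_eqMixin rtree.
HB.instance Definition _ := gen_choiceMixin rtree.

Lemma tree_iso_size t s (f : seq nat -> seq nat) :
  set_bij (vertex t) (vertex s) f -> f [::] = [::] ->
  (forall u, vertex t u -> f (parent u) = parent (f u)) ->
  forall u, vertex t u -> size (f u) = size u.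
Proof.
move=> [ff finj _] f0 fp; elim/last_ind => [_|u i IH tu]; first by rewrite f0.
have := fp _ tu; rewrite parent_rcons => fpu.
have : size (f (rcons u i)) != 0.
  apply/negP => /eqP/size0nil fu.
  have : rcons u i = [::] by apply: finj; rewrite ?inE ?fu ?f0//; exact: vertex_root.
  by move/(congr1 size); rewrite size_rcons.
have := IH (vertex_parent tu).
by rewrite fpu size_parent size_rcons; case: (size (f _)) => //= n ->.
Qed.

Program Definition rtree_trunc (n : nat) (t : rtree) : rtree :=
  @RTree [set u | vertex t u /\ (size u <= n)%N] _ _ _.
Next Obligation. by split => //; exact: vertex_root. Qed.
Next Obligation.
move=> n t u i [tu +]; rewrite size_rcons => /ltnW ?; split => //.
exact: vertex_parent tu.
Qed.
Next Obligation.
move=> n t u; apply: sub_finite_set (finite_children t u) => i; by case.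
Qed.

Program Definition rtree_root : rtree := @RTree [set [::]] _ _ _.
Next Obligation. by []. Qed.
Next Obligation. by move=> u i /(congr1 size); rewrite size_rcons. Qed.
Next Obligation.
move=> u; rewrite (_ : mkset _ = set0)//; apply/seteqP; split => // i.
by move=> /(congr1 size); rewrite size_rcons.
Qed.

Lemma rtree_trunc_iso n t s :
  tree_iso t s -> tree_iso (rtree_trunc n t) (rtree_trunc n s).
Proof.
move=> [f [fbij f0 fp]]; have fs := tree_iso_size fbij f0 fp.
have [ff finj fsurj] := fbij.
exists f; split => //.
- split.
  + by move=> u [tu un]; split; [exact: ff|rewrite fs].
  + by move=> u v /[!inE] -[tu _] [tv _]; apply: finj; rewrite inE.
  + move=> v [sv vn]; have [u tu fu] := fsurj _ sv.
    by exists u => //; split => //; rewrite -fs// fu.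
- by move=> u [tu _]; exact: fp.
Qed.

Lemma rtree_level_finite (t : rtree) n : finite_set (vertex (rtree_trunc n t)).
Proof.
elim: n => [|n IH].
  apply: (sub_finite_set _ (finite_set1 [::])) => u [_].
  by rewrite leqn0 => /nilP.
have fin : finite_set (\bigcup_(u in vertex (rtree_trunc n t))
    ((fun i => rcons u i) @` [set i | vertex t (rcons u i)])).
  apply: bigcup_finite => // u _; apply: finite_image; exact: finite_children.
have {}fin := (conj fin (finite_set1 ([::] : seq nat))); rewrite -finite_setU in fin.
apply: sub_finite_set fin => u.
elim/last_ind: u => [|u i _]; first by right.
move=> [tu]; rewrite size_rcons ltnS => un; left; exists u.
  by split => //; exact: vertex_parent tu.
by exists i.
Qed.

Lemma ultra_finite_choice (I : eqType) (F : set_system nat) (g : nat -> I)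
    (A : set I) : UltraFilter F -> finite_set A -> F [set n | A (g n)] ->
  exists2 a, A a & F [set n | g n = a].
Proof.
move=> FU /finite_seqP[s ->]; elim: s => [|a s IH] Fs.
  by exfalso; apply: (@filter_not_empty _ F); apply: filterS Fs => n.
have [Fa|Fa] := in_ultra_setVsetC [set n | g n = a] FU.
  by exists a => //=; rewrite inE eqxx.
have [|b bs Fb] := IH.
  apply: filterS2 Fs Fa => n /=; rewrite inE => /orP[/eqP//|//].
by exists b => //=; rewrite inE bs orbT.
Qed.

(* Koenig's lemma: this is what makes the local distance separate points. *)
Lemma rtree_trunc_iso_all t s :
  (forall n, tree_iso (rtree_trunc n t) (rtree_trunc n s)) -> tree_iso t s.
Proof.
move=> /choice[f fP].
have [F [FU sF]] : exists F : set_system nat, UltraFilter F /\ \oo `<=` F.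
  exact: ultraFilterLemma.
have FF : Filter F by exact: (@ultra_proper _ F).
have FP : ProperFilter F by exact: ultra_proper.
have FI A B : F A -> F B -> F (A `&` B) by exact: filterI.
have Fge m : F [set n | (m <= n)%N] by apply: sF; exists m.
have fsz n u : vertex t u -> (size u <= n)%N -> size (f n u) = size u.
  by move=> tu un; have [bij r0 par] := fP n; apply: (tree_iso_size bij r0 par).
have fin n u : vertex t u -> (size u <= n)%N -> vertex s (f n u).
  by move=> tu un; have [[ff _ _] _ _] := fP n; have [] := ff u (conj tu un).
have /choice[g gP] u : exists v, vertex t u -> vertex s v /\ F [set n | f n u = v].
  have [tu|] := pselect (vertex t u); last by exists [::].
  have [|v [sv _] Fv] := @ultra_finite_choice _ F (f^~ u)
    _ FU (rtree_level_finite s (size u)); last by exists v.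
  apply: filterS (Fge (size u)) => n /= un; split; first exact: fin.
  by rewrite fsz.
have ev u v : vertex t u -> vertex t v ->
    exists n, [/\ (size u <= n)%N, (size v <= n)%N, f n u = g u & f n v = g v].
  move=> tu tv; have [_ Fu] := gP _ tu; have [_ Fv] := gP _ tv.
  have := FI _ _ (FI _ _ (Fge (size u)) (Fge (size v))) (FI _ _ Fu Fv).
  by move=> /filter_ex[n [[? ?] [? ?]]]; exists n.
exists g; split.
- split.
  + by move=> u /gP[].
  + move=> u v /[!inE] tu tv guv; have [n [un vn fu fv]] := ev _ _ tu tv.
    have [[_ finj _] _ _] := fP n.
    by apply: finj; rewrite ?inE ?fu ?fv//; split.
  + move=> v sv.
    have /choice[h hP] n : exists u, (size v <= n)%N ->
        [/\ vertex t u, (size u <= size v)%N & f n u = v].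
      have [vn|] := boolP (size v <= n)%N; last by exists [::].
      have [[_ _ fsurj] _ _] := fP n.
      have [u [tu un] fuv] := fsurj v (conj sv vn).
      by exists u => _; split => //; rewrite -fuv fsz.
    have [|u [tu _] Fu] := @ultra_finite_choice _ F h
        _ FU (rtree_level_finite t (size v)).
      by apply: filterS (Fge (size v)) => n /= /hP[].
    exists u => //; have [_ Fgu] := gP _ tu.
    have := FI _ _ (FI _ _ Fu Fgu) (Fge (size v)).
    by move=> /filter_ex[n /= [[hu fu] /hP[_ _]]]; rewrite hu fu.
- have [n [_ _ <- _]] := ev _ _ (vertex_root t) (vertex_root t).
  by have [_ f0 _] := fP n.
- move=> u tu; have [n [un pn fu fpu]] := ev _ _ tu (rtree_parent tu).
  by rewrite -fu -fpu; have [_ _ fp] := fP n; exact: fp.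
Qed.

Definition tree_isob : rel rtree := fun t s => `[< tree_iso t s >].

Lemma tree_isob_equiv : equiv_class_of tree_isob.
Proof.
split => [t|t s|s t r].
- by apply/asboolP; exact: tree_iso_refl.
- by apply/asboolP/asboolP; exact: tree_iso_sym.
- by move=> /asboolP ts /asboolP sr; apply/asboolP; exact: tree_iso_trans ts sr.
Qed.

Canonical tree_isob_equiv_rel := EquivRelPack tree_isob_equiv.

(* The phantom parameter [R] only serves to let the metric be [R]-valued. *)
Definition ltree (R : realType) : Type := {eq_quot tree_isob}.

Section local_topology.
Context {R : realType}.

HB.instance Definition _ := Choice.on (ltree R).

Definition tree_class (t : rtree) : ltree R := \pi_{eq_quot tree_isob} t.

Definition tree_repr (t : ltree R) : rtree := repr (t : {eq_quot tree_isob}).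

Lemma tree_reprK : cancel tree_repr tree_class.
Proof. exact: reprK. Qed.

Lemma tree_classP (t s : rtree) : tree_class t = tree_class s <-> tree_iso t s.
Proof.
rewrite /tree_class; split => [/eqmodP/asboolP//|ts].
exact/eqmodP/asboolP.
Qed.

Definition trunc (n : nat) (t : ltree R) : ltree R :=
  tree_class (rtree_trunc n (tree_repr t)).

Lemma trunc_class n (t : rtree) : trunc n (tree_class t) = tree_class (rtree_trunc n t).
Proof. by apply/tree_classP/rtree_trunc_iso/tree_classP; rewrite tree_reprK. Qed.

(* The infimum is taken in [\bar R], so that it is [+oo] on the empty set. *)
Definition dloc (t s : ltree R) : R :=
  fine (expeR (- ereal_inf [set n%:R%:E | n in [set n | trunc n t <> trunc n s]])).

Lemma dlocxx t : dloc t t = 0.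
Proof.
rewrite /dloc (_ : [set n | _] = set0) ?image_set0 ?ereal_inf0//.
by rewrite -subset0 => n /=.
Qed.

Lemma dloc_sym t s : dloc t s = dloc s t.
Proof.
by rewrite /dloc; congr (fine (expeR (- ereal_inf (_ @` _)))); apply/seteqP;
  split => n /= /eqP; rewrite eq_sym => /eqP.
Qed.

Lemma dloc_positivity t s : dloc t s = 0 -> t = s.
Proof.
rewrite /dloc => ts0; rewrite -(tree_reprK t) -(tree_reprK s).
apply/tree_classP/rtree_trunc_iso_all => n.
apply: contrapT => tsn; move: ts0.
have {}tsn : trunc n t <> trunc n s by move=> /tree_classP.
set D := [set n : nat | _]; set i := ereal_inf _.
have i_le : (i <= n%:R%:E)%E by apply: ereal_inf_lbound; exists n.
have i_ge : (0 <= i)%E by apply: le_ereal_inf_tmp => _ [k _ <-]; rewrite lee_fin.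
have fi : i \is a fin_num.
  by rewrite ge0_fin_numE//; apply: le_lt_trans i_le _; rewrite ltry.
by apply/eqP; rewrite -(fineK fi) /= gt_eqF// expR_gt0.
Qed.

Lemma expeR_inf_fin_num (D : set nat) :
  expeR (- ereal_inf [set ((n%:R)%:E : \bar R) | n in D]) \is a fin_num.
Proof.
rewrite ge0_fin_numE ?expeR_ge0// ltey expeR_eqy eqe_oppLR.
apply/negP => /eqP i.
have : (0 <= ereal_inf [set ((n%:R)%:E : \bar R) | n in D])%E.
  by apply: le_ereal_inf_tmp => _ [n _ <-]; rewrite lee_fin.
by rewrite i.
Qed.

Lemma dloc_ultra r t s : dloc t s <= Num.max (dloc t r) (dloc r s).
Proof.
rewrite /dloc; set A := [set n : nat | _]; set B := [set n : nat | _];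
  set C := [set n : nat | _].
have : (Order.min (ereal_inf [set ((n%:R)%:E : \bar R) | n in B])
                (ereal_inf [set ((n%:R)%:E : \bar R) | n in C]) <=
      ereal_inf [set ((n%:R)%:E : \bar R) | n in A])%E.
  apply: le_ereal_inf_tmp => _ [n An <-]; rewrite ge_min.
  have [Bn|/contrapT nB] := pselect (B n).
    by apply/orP; left; apply: ereal_inf_lbound; exists n.
  apply/orP; right; apply: ereal_inf_lbound; exists n => //.
  by rewrite /C/= -nB.
rewrite ge_min le_max => /orP[] le; apply/orP; [left|right];
  by apply: fine_le; rewrite ?expeR_inf_fin_num// lee_expeR leeN2.
Qed.

Lemma dloc_triangle r t s : dloc t s <= dloc t r + dloc r s.
Proof.
apply: le_trans (dloc_ultra r t s) _.
by rewrite ge_max lerDl lerDr !fine_ge0 ?expeR_ge0.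
Qed.

HB.instance Definition _ := isMetric.Build R (ltree R)
  dlocxx dloc_positivity dloc_sym dloc_triangle.
HB.instance Definition _ := isPointed.Build (ltree R) (tree_class rtree_root).

HB.instance Definition _ := @isMeasurable.Build (sigma_display (@open (ltree R)))
  (ltree R) <<s @open (ltree R) >> (@sigma_algebra0 _ setT _) (@sigma_algebraC _ _)
  (@sigma_algebra_bigcup _ setT _).

End local_topology.

(** * The alpha-gamma model *)

(* Plane representatives of the finite trees visited by the growth process. *)
Inductive ftree := FNode of seq ftree.

HB.instance Definition _ := gen_eqMixin ftree.

Definition fleaf : ftree := FNode [::].

Fixpoint fvertex (t : ftree) (u : seq nat) {struct u} : Prop :=
  match u, t with
  | [::], _ => True
  | i :: w, FNode s => if onth s i is Some c then fvertex c w else False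
  end.

Program Definition rtree_of (t : ftree) : rtree := @RTree (fvertex t) _ _ _.
Next Obligation. by []. Qed.
Next Obligation.
move=> t u i; elim: u t => [//|j u IH] [s] /=.
by case: (onth s j) => // c; exact: IH.
Qed.
Next Obligation.
move=> t u; elim: u t => [|j u IH] [s] /=.
  apply: (sub_finite_set _ (finite_II (size s))) => i /=.
  by case E: (onth s i) => [c|//] _; rewrite -onthTE E.
by case: (onth s j) => [c|]; [exact: IH|exact: (sub_finite_set _ (finite_set0 _))].
Qed.

Record AG_param (R : realType) := AGParam {
  ag_alpha : R ;
  ag_gamma : R ;
  ag_gamma_ge0 : 0 <= ag_gamma ;
  ag_gamma_le : ag_gamma <= ag_alpha ;
  ag_alpha_le1 : ag_alpha <= 1 }.

Section alpha_gamma.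
Context {R : realType} (p : AG_param R).
Let alpha := ag_alpha p.
Let gamma := ag_gamma p.

Definition growth_forest (growth : ftree -> seq (R * ftree)) :=
  fix grow (s : seq ftree) : seq (R * seq ftree) :=
    if s is c :: s' then
      [seq (x.1, x.2 :: s') | x <- growth c] ++ [seq (x.1, c :: x.2) | x <- grow s']
    else [::].

(* [growth t] lists all the ways of inserting a leaf into the planted tree [t],
   each with its weight; the first one inserts it in the middle of the edge that
   ends at the root of [t] (the phantom edge when [t] is the whole tree), the
   second one (absent for a leaf) at the root itself. *)
Fixpoint growth (t : ftree) : seq (R * ftree) :=
  let: FNode s := t in
  (if s is [::] then 1 - alpha else gamma, FNode [:: t; fleaf]) ::
  (if s is [::] then [::]
   else [:: (((size s)%:R - 1) * alpha - gamma, FNode (rcons s fleaf))]) ++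
  [seq (x.1, FNode x.2) | x <- growth_forest growth s].

(* The law of [T_n] as a list of trees with their probabilities; the same tree
   may occur several times. The value at [n = 0] is a dummy. *)
Fixpoint AG_dist (n : nat) : seq (R * ftree) :=
  match n with
  | 0 => [:: (1, fleaf)]
  | m.+1 =>
    match m with
    | 0 => [:: (1, fleaf)]
    | 1 => [:: (1, FNode [:: fleaf; fleaf])]
    | _ => [seq (q.1 * (x.1 / \sum_(y <- growth q.2) y.1), x.2)
              | q <- AG_dist m, x <- growth q.2]
    end
  end.

Definition AG_fun (n : nat) (A : set (ltree R)) : \bar R :=
  (\sum_(q <- AG_dist n) q.1%:E * \d_(tree_class (rtree_of q.2)) A)%E.

Fixpoint nleaves (t : ftree) : nat :=
  let: FNode s := t in if s is [::] then 1 else sumn (map nleaves s).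

Fixpoint branching (t : ftree) : bool :=
  let: FNode s := t in (size s != 1) && all branching s.

Lemma ftree_ind2 (P : ftree -> Prop) (Q : seq ftree -> Prop) :
  Q [::] -> (forall c s, P c -> Q s -> Q (c :: s)) ->
  (forall s, Q s -> P (FNode s)) -> forall t, P t.
Proof.
move=> Q0 QS PQ; fix IH 1 => -[s]; apply: PQ.
by elim: s => [//|c s Qs]; exact: QS.
Qed.

Lemma growth_weight t : \sum_(x <- growth t) x.1 = (nleaves t)%:R - alpha.
Proof.
move: t; apply: (@ftree_ind2 _ (fun s => \sum_(x <- growth_forest growth s) x.1
   = (sumn (map nleaves s))%:R - (size s)%:R * alpha)) => [|c s|s] /=.
- by rewrite big_nil mul0r subr0.
- move=> IHc IHs; rewrite big_cat !big_map/= IHc IHs natrD -[(size s).+1]addn1 natrD.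
  by ring.
- case: s => [_|c s IH] /=; first by rewrite big_cons big_nil/= addr0.
  rewrite 2!big_cons big_map -/(growth_forest growth (c :: s)) in IH *.
  by rewrite IH /= -[(size s).+1]addn1 natrD; ring.
Qed.

Lemma growthP t : branching t ->
  all (fun x => [&& 0 <= x.1, nleaves x.2 == (nleaves t).+1 & branching x.2])
      (growth t).
Proof.
have g0 : 0 <= gamma := ag_gamma_ge0 p.
have ga : gamma <= alpha := ag_gamma_le p.
have a1 : alpha <= 1 := ag_alpha_le1 p.
move: t; apply: (@ftree_ind2 _ (fun s => all branching s ->
   all (fun x : R * seq ftree => [&& 0 <= x.1, size x.2 == size s,
        sumn (map nleaves x.2) == (sumn (map nleaves s)).+1 & all branching x.2])
   (growth_forest growth s))) => [//|c s IHc IHs|s IHs] /=.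
- move=> /andP[bc bs]; rewrite all_cat !all_map; apply/andP; split.
    apply: sub_all (IHc bc) => x /= /and3P[-> /eqP -> ->].
    by rewrite bs eqxx/= addSn eqxx.
  apply: sub_all (IHs bs) => x /= /and4P[-> /eqP -> /eqP -> ->].
  by rewrite bc eqxx/= addnS eqxx.
- move=> /andP[s1 bs]; have H := IHs bs; rewrite all_cat all_map; apply/and3P; split.
  + apply/and3P; split => //=.
    * by case: (s) => [|? ?]; rewrite ?subr_ge0.
    * by rewrite addn0 addn1.
    * by rewrite s1 bs.
  + case: s s1 bs {IHs H} => [//|c [//|c' s]] _ /= /and3P[bc bc' bs].
    rewrite map_rcons sumn_rcons all_rcons bc bc' bs /= !andbT.
    apply/andP; split; last by rewrite !addnA addn1.
    rewrite subr_ge0; apply: (le_trans ga).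
    rewrite ler_peMl ?(le_trans g0)//.
    by rewrite -addn1 natrD addrK ler1n.
  + apply: sub_all H => -[w s'] /= /and4P[-> /eqP ss' /eqP le ->].
    rewrite ss' s1 andbT.
    by move: ss' le; case: (s') => [|? ?]; case: (s) => [|? ?] //= _ ->; rewrite eqxx.
Qed.

Lemma AG_distP n : all (fun q => [&& 0 <= q.1, nleaves q.2 == maxn n 1 & branching q.2])
    (AG_dist n) /\ \sum_(q <- AG_dist n) q.1 = 1.
Proof.
elim: n => [|[|[|n]] IH]; try by rewrite /= big_seq1 ler01; split.
have {IH}[IH1 IH2] := IH.
pose W t := \sum_(y <- growth t) y.1.
have Wgt0 q : q \in AG_dist n.+2 -> 0 < W q.2.
  move=> /(allP IH1) /and3P[_ /eqP q2 _]; rewrite /W growth_weight q2 subr_gt0.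
  by apply: le_lt_trans (ag_alpha_le1 p) _; rewrite ltr1n.
rewrite [AG_dist n.+3]/=; split.
- apply/allP => _ /allpairsPdep[q [x [qs xs ->]]] /=.
  have /and3P[q1 /eqP q2 bq] := allP IH1 _ qs.
  have /and3P[x1 /eqP x2 bx] := allP (growthP bq) _ xs.
  rewrite bx x2 q2 !eqxx !andbT mulr_ge0// divr_ge0//.
  exact: ltW (Wgt0 _ qs).
- rewrite big_allpairs_dep/= -[RHS]IH2 [LHS]big_seq [RHS]big_seq.
  apply: eq_bigr => q /Wgt0 Wq.
  by rewrite -mulr_sumr -mulr_suml divff ?mulr1// gt_eqF.
Qed.

Lemma AG_dist_ge0 n i : 0 <= (nth (0, fleaf) (AG_dist n) i).1.
Proof.
have [h _] := AG_distP n.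
have [i_lt|i_ge] := ltnP i (size (AG_dist n)); last by rewrite nth_default.
by have /and3P[] := allP h _ (mem_nth (0, fleaf) i_lt).
Qed.

Lemma AG_funE n : AG_fun n =
  msum (fun i => mscale (NngNum (AG_dist_ge0 n i))
    \d_(tree_class (rtree_of (nth (0, fleaf) (AG_dist n) i).2))) (size (AG_dist n)).
Proof.
apply/funext => A; rewrite /AG_fun (big_nth (0, fleaf)) big_mkord /msum.
by apply: eq_bigr => i _.
Qed.

Let AG_fun0 n : AG_fun n set0 = 0%E.
Proof. by rewrite AG_funE measure0. Qed.

Let AG_fun_ge0 n A : (0 <= AG_fun n A)%E.
Proof. by rewrite AG_funE measure_ge0. Qed.

Let AG_fun_sigma_additive n : semi_sigma_additive (AG_fun n).
Proof. rewrite AG_funE; exact: measure_semi_sigma_additive. Qed.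

HB.instance Definition _ n := isMeasure.Build _ _ _ (AG_fun n)
  (AG_fun0 n) (AG_fun_ge0 n) (@AG_fun_sigma_additive n).

Let AG_funT n : AG_fun n setT = 1%E.
Proof.
have [_ h] := AG_distP n; transitivity (\sum_(q <- AG_dist n) q.1)%:E; last by rewrite h.
by rewrite -sumEFin; apply: eq_bigr => q _; rewrite diracT mule1.
Qed.

HB.instance Definition _ n := Measure_isProbability.Build _ _ _ (AG_fun n) (AG_funT n).

Definition AG (n : nat) : probability (ltree R) R := AG_fun n.

End alpha_gamma.

(** * The limiting tree *)

(* [spine_vertex X tau n u]: the word [u] is a vertex of the part of the tree
   lying above [v_n]. The child [0] of [v_n] is [v_{n+1}], and its child
   [k.+1], for [k <= X n], is the root of [tau n k]. *)
Fixpoint spine_vertex (X : nat -> nat) (tau : nat -> nat -> rtree) (n : nat)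
    (u : seq nat) {struct u} : Prop :=
  match u with
  | [::] => True
  | 0 :: w => spine_vertex X tau n.+1 w
  | k.+1 :: w => (k <= X n)%N /\ vertex (tau n k) w
  end.

Program Definition spine_rtree (X : nat -> nat) (tau : nat -> nat -> rtree) : rtree :=
  @RTree (spine_vertex X tau 0) _ _ _.
Next Obligation. by []. Qed.
Next Obligation.
move=> X tau u i; elim: u (0%N) => [//|[|k] u IH] n /=; first exact: IH.
by move=> [kX tu]; split => //; exact: vertex_parent tu.
Qed.
Next Obligation.
move=> X tau u; elim: u (0%N) => [|[|k] u IH] n /=; last 2 first.
- exact: IH.
- by apply: (sub_finite_set _ (finite_children (tau n k) u)) => i [].
apply: (sub_finite_set _ (finite_II (X n).+2)) => -[//|i] /= [iX _].
by rewrite !ltnS.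
Qed.

Lemma parent_cons i u : parent (i :: u) = if u is [::] then [::] else i :: parent u.
Proof. by case: u. Qed.

Lemma spine_rtree_trunc N (X X' : nat -> nat) (tau tau' : nat -> nat -> rtree) :
  (forall n, (n <= N)%N -> X n = X' n) ->
  (forall n k, (n <= N)%N -> (k <= X n)%N ->
    tree_iso (rtree_trunc N (tau n k)) (rtree_trunc N (tau' n k))) ->
  tree_iso (rtree_trunc N (spine_rtree X tau)) (rtree_trunc N (spine_rtree X' tau')).
Proof.
move=> XX' iso.
have /choice[f fP] nk : exists f : seq nat -> seq nat, (nk.1 <= N)%N -> (nk.2 <= X nk.1)%N ->
    [/\ forall u, vertex (tau nk.1 nk.2) u -> (size u <= N)%N ->
          vertex (tau' nk.1 nk.2) (f u) /\ size (f u) = size u,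
      forall u v, vertex (tau nk.1 nk.2) u -> vertex (tau nk.1 nk.2) v ->
         (size u <= N)%N -> (size v <= N)%N -> f u = f v -> u = v,
      forall v, vertex (tau' nk.1 nk.2) v -> (size v <= N)%N ->
         exists u, [/\ vertex (tau nk.1 nk.2) u, size u = size v & f u = v],
      f [::] = [::] &
      forall u, vertex (tau nk.1 nk.2) u -> (size u <= N)%N -> f (parent u) = parent (f u)].
  have [nN|nN] := leqP nk.1 N; last by exists id.
  have [kX|kX] := leqP nk.2 (X nk.1); last by exists id.
  have [g [gbij g0 gp]] := iso _ _ nN kX.
  have gs := tree_iso_size gbij g0 gp; have [gf ginj gsurj] := gbij.
  exists g => _ _; split => //.
  - by move=> u tu uN; have [? ?] := gf u (conj tu uN); split => //; apply: gs; split.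
  - by move=> u v tu tv uN vN; apply: ginj; rewrite inE; split.
  - move=> v tv vN; have [u [tu uN] guv] := gsurj v (conj tv vN).
    by exists u; split => //; rewrite -guv (gs u (conj tu uN)).
  - by move=> u tu uN; apply: gp; split.
pose F := fix F n (u : seq nat) : seq nat := match u with
  | [::] => [::] | 0 :: w => 0%N :: F n.+1 w | k.+1 :: w => k.+1 :: f (n, k) w end.
have Fsize n u : spine_vertex X tau n u -> (n + size u <= N)%N ->
    spine_vertex X' tau' n (F n u) /\ size (F n u) = size u.
  elim: u n => [//|[|k] u IH] n /=.
    by move=> su nu; have [|? ->] := IH _ su; first by rewrite addSnnS.
  move=> [kX tu] nu; have nN : (n <= N)%N by apply: leq_trans nu; exact: leq_addr.
  have [fs _ _ _ _] := fP (n, k) nN kX.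
  have [|? ->] := fs _ tu; first by lia.
  by rewrite -XX'.
have Finj n u v : spine_vertex X tau n u -> spine_vertex X tau n v ->
    (n + size u <= N)%N -> (n + size v <= N)%N -> F n u = F n v -> u = v.
  elim: u n v => [|[|k] u IH] n [|[|l] v] //=.
    by move=> su sv nu nv [] /IH -> //; lia.
  move=> [kX tu] [lX tv] nu nv [kl]; move: lX tv; rewrite -kl => lX tv fuv.
  have nN : (n <= N)%N by lia.
  have [_ finj _ _ _] := fP (n, k) nN kX.
  by congr cons; apply: finj fuv => //; lia.
have Fsurj n v : spine_vertex X' tau' n v -> (n + size v <= N)%N ->
    exists u, [/\ spine_vertex X tau n u, size u = size v & F n u = v].
  elim: v n => [|[|k] v IH] n /=.
  - by exists [::].
  - move=> sv nv; have [|u [su us uv]] := IH _ sv; first by lia.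
    by exists (0%N :: u); rewrite /= us uv.
  - move=> [kX tv] nv; have nN : (n <= N)%N by lia.
    move: kX; rewrite -XX'// => kX.
    have [_ _ fsurj _ _] := fP (n, k) nN kX.
    have [|u [tu us uv]] := fsurj _ tv; first by lia.
    by exists (k.+1 :: u); rewrite /= us uv.
have Fpar n u : spine_vertex X tau n u -> (n + size u <= N)%N ->
    F n (parent u) = parent (F n u).
  elim: u n => [//|[|k] u IH] n /=.
    move=> su nu; rewrite !parent_cons.
    have [|_ +] := Fsize _ _ su; first by lia.
    case: u su nu IH => [//|j u] su nu IH.
    case E : (F _ _) => [//|i w] _.
    by rewrite -[RHS]/(0%N :: parent (i :: w)) -E -IH//; lia.
  move=> [kX tu] nu; have nN : (n <= N)%N by lia.
  have [fs _ _ f0 fp] := fP (n, k) nN kX; rewrite !parent_cons.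
  have [|_ +] := fs _ tu; first by lia.
  case: u tu nu {IH} => [|j u] tu nu /=; first by rewrite f0.
  case E : (f _ _) => [//|i w] _.
  by rewrite -[RHS]/(k.+1 :: parent (i :: w)) -E -fp//=; move: nu => /=; lia.
exists (F 0%N); split => //.
- split.
  + by move=> u [su uN]; have [? us] := Fsize _ _ su uN; split; rewrite ?us.
  + by move=> u v /[!inE] -[su uN] [sv vN]; exact: Finj.
  + move=> v [sv vN]; have [u [su us uv]] := Fsurj _ _ sv vN.
    by exists u => //; split => //; rewrite us.
- by move=> u [su uN]; exact: Fpar.
Qed.

Section limit_tree.
Context {R : realType}.

Definition spine_tree (X : nat -> nat) (tau : nat -> nat -> ltree R) : ltree R :=
  tree_class (spine_rtree X (fun n k => tree_repr (tau n k))).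

Lemma rtree_trunc_le m n t : (m <= n)%N ->
  rtree_trunc m (rtree_trunc n t) = rtree_trunc m t.
Proof.
move=> mn; apply: rtree_eq; apply/seteqP; split => u /=; first by case=> -[].
by move=> [tu um]; split => //; split => //; exact: leq_trans um mn.
Qed.

Lemma trunc_le m n (t : ltree R) : (m <= n)%N -> trunc m (trunc n t) = trunc m t.
Proof. by move=> mn; rewrite {2}/trunc trunc_class rtree_trunc_le. Qed.

Lemma dloc_le (N : nat) (t s : ltree R) :
  trunc N t = trunc N s -> dloc t s <= expR (- N%:R).
Proof.
move=> ts; rewrite -lee_fin fineK ?expeR_inf_fin_num//.
rewrite -[leRHS]/(expeR (- N%:R%:E)) lee_expeR leeN2.
apply: le_ereal_inf_tmp => _ [n /= tsn <-]; rewrite lee_fin ler_nat leqNgt.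
by apply/negP => nN; apply: tsn; rewrite -(trunc_le t (ltnW nN)) ts trunc_le// ltnW.
Qed.

Lemma dloc_lt (N : nat) (t s : ltree R) :
  dloc t s < expR (- N%:R) -> trunc N t = trunc N s.
Proof.
rewrite -lte_fin fineK ?expeR_inf_fin_num//.
rewrite -[ltRHS]/(expeR (- N%:R%:E)) lte_expeR lteN2 => lt.
apply: contrapT => ts; move: lt; apply/negP; rewrite -leNgt.
by apply: ereal_inf_lbound; exists N.
Qed.

Lemma open_trunc (U : set (ltree R)) t : open U -> U t ->
  exists N, forall s, trunc N t = trunc N s -> U s.
Proof.
move=> oU Ut; have : nbhs t U by apply: open_nbhs_nbhs.
rewrite -nbhs_ballE => -[e /= e0 tU].
exists (Num.bound `|ln e|) => s /dloc_le ts; apply: tU.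
rewrite ballEmdist/=; apply: le_lt_trans ts _.
rewrite -[ltRHS](@lnK R)// ltr_expR ltrNl.
apply: le_lt_trans (archi_boundP (normr_ge0 (ln e))).
by rewrite -normrN ler_norm.
Qed.

Lemma trunc_open N t : open [set s : ltree R | trunc N t = trunc N s].
Proof.
rewrite openE => s /= ts; rewrite /interior -nbhs_ballE.
exists (expR (- N%:R)) => /=; first exact: expR_gt0.
by move=> r; rewrite ballEmdist/= => /dloc_lt <-.
Qed.

Let code N (t : ltree R) : {fset seq nat} :=
  fset_set (vertex (rtree_trunc N (tree_repr (trunc N t)))).

Let codeP N t s : code N t = code N s <-> trunc N t = trunc N s.
Proof.
split; last by rewrite /code => ->.
rewrite /code => /fset_set_inj h.
rewrite -(trunc_le t (leqnn N)) -(trunc_le s (leqnn N)) {1 3}/trunc.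
by congr tree_class; apply: rtree_eq; apply: h; exact: rtree_level_finite.
Qed.

Section measurability.
Context d (Omega : measurableType d).

Let dm (C : Type) (f : Omega -> C) := forall c, measurable (f @^-1` [set c]).

Let dm_map (I C : Type) (f : I -> Omega -> C) (l : seq I) :
  (forall i, dm (f i)) -> dm (fun w => [seq f i w | i <- l]).
Proof.
move=> df; elim: l => [|i l IH] c.
  rewrite /preimage/=; case: c => [|a c].
    by rewrite (_ : mkset _ = setT)//; apply/seteqP; split.
  by rewrite (_ : mkset _ = set0)//; apply/seteqP; split.
rewrite /preimage/=; case: c => [|a c].
  by rewrite (_ : mkset _ = set0)//; apply/seteqP; split.
rewrite (_ : mkset _ = f i @^-1` [set a] `&` (fun w => [seq f i w | i <- l]) @^-1` [set c]).
  by apply: measurableI; [exact: df|exact: IH].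
by apply/seteqP; split => w /= [-> ->].
Qed.

Let dm_dep (C : Type) (f : Omega -> nat) (g : nat -> Omega -> C) :
  dm f -> (forall m, dm (g m)) -> dm (fun w => (f w, g (f w) w)).
Proof.
move=> df dg [m c]; rewrite /preimage/=.
rewrite (_ : mkset _ = f @^-1` [set m] `&` g m @^-1` [set c]).
  by apply: measurableI; [exact: df|exact: dg].
by apply/seteqP; split => w /=; [move=> [<- <-]|move=> [-> <-]].
Qed.

Lemma measurable_spine_tree (X : nat -> {mfun Omega >-> nat})
    (tau : nat -> nat -> {mfun Omega >-> ltree R}) :
  measurable_fun setT (fun w => spine_tree (X ^~ w) (fun n k => tau n k w)).
Proof.
apply: (measurability (@open (ltree R))) => //.
move=> _ [U oU <-]; rewrite setTI.
set T := fun w => spine_tree _ _.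
pose h N w := [seq (X n w, [seq code N (tau n k w) | k <- iota 0 (X n w).+1])
                 | n <- iota 0 N.+1].
have dmh N : dm (h N).
  apply: dm_map => n; apply: (@dm_dep _ (X n) (fun m w => [seq code N (tau n k w) | k <- iota 0 m.+1])).
    by move=> m; rewrite -[X in measurable X]setTI; exact: measurable_funP.
  move=> m; apply: dm_map => k c.
  have [[t tc]|nt] := pselect (exists t, code N t = c); last first.
    rewrite (_ : _ @^-1` _ = set0)//; apply/seteqP; split => // w /= wc.
    by apply: nt; exists (tau n k w).
  rewrite (_ : _ @^-1` _ = tau n k @^-1` [set s | trunc N t = trunc N s]); last first.
    by apply/seteqP; split => w /=; rewrite -tc => /codeP.
  rewrite -[X in measurable X]setTI; apply: measurable_funP => //.
  by apply: sub_sigma_algebra; exact: trunc_open.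
have hT N w w' : h N w = h N w' -> trunc N (T w) = trunc N (T w').
  move=> hw; rewrite /T /spine_tree !trunc_class; apply/tree_classP.
  have hn n : (n <= N)%N -> (X n w, [seq code N (tau n k w) | k <- iota 0 (X n w).+1]) =
      (X n w', [seq code N (tau n k w') | k <- iota 0 (X n w').+1]).
    move=> nN; move: hw => /eq_in_map; apply.
    by rewrite mem_iota.
  apply: spine_rtree_trunc => [n /hn[]//|n k nN].
  have /pair_equal_spec[XX e] := hn n nN; rewrite -ltnS => kX.
  apply/(@tree_classP R)/codeP.
  by move: e; rewrite -XX => /eq_in_map; apply; rewrite mem_iota.
pose G N := [set c | exists w', h N w' = c /\ forall s, trunc N (T w') = trunc N s -> U s].
rewrite (_ : T @^-1` U = \bigcup_N \bigcup_(c in G N) (h N @^-1` [set c])).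
  apply: bigcup_measurable => N _.
  rewrite bigcup_mkcond; apply: countable_bigcupT_measurable => [|c].
    exact: countableP.
  by case: ifP => // _; exact: dmh.
apply/seteqP; split => w /=.
  move=> /(open_trunc oU)[N NU]; exists N => //; exists (h N w) => //.
  by exists w.
by move=> [N _ [_ [w' [<- w'U]] /= ww']]; apply: w'U; exact: hT.
Qed.

Definition spine_rv (X : nat -> {mfun Omega >-> nat})
    (tau : nat -> nat -> {mfun Omega >-> ltree R}) (w : Omega) : ltree R :=
  spine_tree (X ^~ w) (fun n k => tau n k w).

HB.instance Definition _ X tau := isMeasurableFun.Build _ _ _ _ (spine_rv X tau)
  (measurable_spine_tree X tau).

End measurability.
End limit_tree.

Section laws.
Context {R : realType}.

Definition Gamma (x : R) : R :=
  \int[lebesgue_measure]_(t in `]0, +oo[) (t `^ (x - 1) * expR (- t)).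

(* Mass function of the beta geometric law with parameters [(theta, 1 - theta)]. *)
Definition beta_geometric (theta : R) (n : nat) : R :=
  if theta == 1 then (n == 0)%:R
  else theta * Gamma (n%:R + 1 - theta) / (Gamma (1 - theta) * (n.+1)`!%:R).

Definition mutually_independent d (Omega : measurableType d) (P : probability Omega R)
    (I : choiceType) (F : I -> set_system Omega) : Prop :=
  forall (J : {fset I}) (E : I -> set Omega), (forall i, i \in J -> F i (E i)) ->
    P (\bigcap_(i in [set` J]) E i) = (\prod_(i <- J) P (E i))%E.

(* The families driving the construction of the infinite tree; the law of
   [AG^infty] is the distribution of [spine_rv X tau] for any such family. *)
Record AG_infty_family (p : AG_param R) d (Omega : measurableType d)
    (P : probability Omega R) (X : nat -> {RV P >-> nat})
    (Y : nat -> nat -> {RV P >-> nat}) (tau : nat -> nat -> {RV P >-> ltree R}) : Prop := {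
  AG_X_law : forall n l, P (X n @^-1` [set l]) =
    (beta_geometric (ag_gamma p / ag_alpha p) l)%:E ;
  AG_Y_law : forall n k l, P (Y n k @^-1` [set l]) = (beta_geometric (ag_alpha p) l)%:E ;
  AG_tau_law : forall n k l (A : set (ltree R)), measurable A ->
    P (Y n k @^-1` [set l] `&` tau n k @^-1` A) =
    (P (Y n k @^-1` [set l]) * AG p l.+1 A)%E ;
  AG_independent : mutually_independent P (fun i : nat + nat * nat =>
    match i with
    | inl n => preimage_set_system setT (X n) measurable
    | inr (n, k) => preimage_set_system setT (fun w => (Y n k w, tau n k w)) measurable
    end) }.

Definition weakly_converges (mu : nat -> probability (ltree R) R)
    (nu : probability (ltree R) R) : Prop :=
  forall f : ltree R -> R, continuous f -> bounded_fun f ->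
    (\int[mu n]_t (f t)%:E @[n --> \oo] --> \int[nu]_t (f t)%:E)%E.

End laws.

(* Main.v *)
Require Import Defs.
From HB Require Import structures.
From mathcomp Require Import all_boot all_order all_algebra finmap.
From mathcomp Require Import all_classical all_reals all_analysis.
From mathcomp Require Import measurable_realfun.
From mathcomp Require Import ring lra zify.

(** Along the growth, almost all the leaves end up above one child of the root,
    and what hangs from the root beside that child has a limiting law, which
    solves a linear recursion.

    The root. An insertion into [FNode (b :: s)] takes place on the phantom edge,
    and then the whole tree becomes the first child with one leaf beside it, or
    among the siblings [s], or inside [b]. Let [phi] be a function of the siblings
    that vanishes on the forests whose number of leaves is not [m]. The mean a_n of
    [phi s] under the law of T_n satisfies
      (n - alpha) a_(n+1) (phi) =
        (n - m - alpha) a_n (phi) + gamma phi [leaf] + a_n (G phi),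
    where G phi, the weighted sum of [phi] over the insertions among the siblings, is
    concentrated on forests with [m - 1] leaves ([sibling_mean_rec]). Moreover the
    first child is independent of [s], with law AG^(n - m), once [m] is fixed
    ([AG_mean_split]). By induction on [m] and a convergence lemma for such
    recursions ([cvg_relaxation]), a_n (phi) has a limit, determined by
      m L (phi) = gamma phi [leaf] + L (G phi).

    The limit. If [phi] is invariant under permutations, the mean of [phi] over
    X + 1 independent trees with laws AG^(Y + 1) satisfies the same equation
    ([siblings_mean_rec]), because consecutive masses of the two beta geometric
    laws are in the right ratio, by the functional equation of the Gamma function
    ([GammaS]). Invariance is essential: the plane representative lists the siblings
    in order of arrival, and in that order they are not exchangeable in the limit.

    Balls. Iterating N times along first children, the probability that the N first
    vertices of this spine carry N given multisets of trees converges to a product of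
    limits at the root ([cvg_code_mean]). By independence this product is the
    probability of the same event for the infinite tree ([code_law]), and the event
    determines the ball of radius N - 1 ([trunc_fclass_keys], [trunc_spine_tree_keys]).

    Weak convergence. These events form a countable partition, up to a null set, of
    the space on which the infinite tree is defined. For a continuous g >= 0, finitely
    many of them, on each of which g is almost constant, carry almost all of the mass;
    hence the liminf of the integrals of g is at least its integral under the limiting
    law ([liminf_AG]). No mass can escape, since this applies to C + f and to C - f for
    a bounded f. *)

Set Implicit Arguments.
Unset Strict Implicit.
Unset Printing Implicit Defensive.

Import Order.TTheory GRing.Theory Num.Theory.
Import numFieldNormedType.Exports.

Local Open Scope classical_set_scope.
Local Open Scope ring_scope.

(** * Growth of the root decomposition *)

Section growth.
Context {R : realType} (p : AG_param R).
Let alpha := ag_alpha p.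
Let gamma := ag_gamma p.

Definition AG_mean n (f : ftree -> R) : R := \sum_(q <- AG_dist p n) q.1 * f q.2.

Definition tree_growth (f : ftree -> R) (t : ftree) : R :=
  \sum_(x <- growth p t) x.1 * f x.2.

Definition forest_growth (phi : seq ftree -> R) (s : seq ftree) : R :=
  \sum_(x <- growth_forest (growth p) s) x.1 * phi x.2.

Definition forest_leaves (s : seq ftree) : nat := sumn (map nleaves s).

(** The number of leaves of the siblings is the induction parameter of the limit:
    an insertion among the siblings raises it by one, so the dual operator
    [sibling_growth] lowers the degree by one. *)
Definition graded m (phi : seq ftree -> R) :=
  forall s, forest_leaves s != m -> phi s = 0.

Definition root_split (phi : seq ftree -> R) (h : ftree -> R) (t : ftree) : R :=
  if t is FNode (b :: s) then phi s * h b else 0.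

(** Total weight of the insertions at the root or above the siblings [s], tested
    against [phi]: beside [size s] siblings the root has [size s + 1] children,
    hence its weight [size s * alpha - gamma]. *)
Definition sibling_growth (phi : seq ftree -> R) (s : seq ftree) : R :=
  ((size s)%:R * alpha - gamma) * phi (rcons s fleaf) + forest_growth phi s.

Lemma nleaves_gt0 t : (0 < nleaves t)%N.
Proof.
move: t; apply: (@ftree_ind2 _ (fun s => (size s <= forest_leaves s)%N)) => //.
  by move=> c s cP sP; rewrite /forest_leaves/= -add1n leq_add.
by case=> [//|c s] /= h; apply: leq_ltn_trans h.
Qed.

Lemma size_forest_leaves s : (size s <= forest_leaves s)%N.
Proof.
elim: s => //= c s sP; rewrite /forest_leaves/= -add1n leq_add//.
exact: nleaves_gt0.
Qed.

Lemma alpha_lt n : (1 < n)%N -> 0 < n%:R - alpha.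
Proof.
by move=> n1; rewrite subr_gt0 (le_lt_trans (ag_alpha_le1 p))// ltr1n.
Qed.

Lemma AG_dist_leaves n q : (0 < n)%N -> q \in AG_dist p n ->
  [/\ 0 <= q.1, nleaves q.2 = n & branching q.2].
Proof.
move=> n0 qn; have [/allP/(_ _ qn)/and3P[-> /eqP-> ->] _] := AG_distP p n.
by split => //; apply/maxn_idPl.
Qed.

Lemma AG_mean1 n : AG_mean n (fun=> 1) = 1.
Proof.
have [_ h] := AG_distP p n; rewrite -[RHS]h.
by apply: eq_bigr => q _; rewrite mulr1.
Qed.

Lemma eq_AG_mean n f g : (0 < n)%N ->
  (forall t, nleaves t = n -> branching t -> f t = g t) -> AG_mean n f = AG_mean n g.
Proof.
move=> n0 fg; rewrite /AG_mean big_seq [RHS]big_seq; apply: eq_bigr => q qn.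
by have [_ ? ?] := AG_dist_leaves n0 qn; rewrite fg.
Qed.

Lemma AG_meanD n f g : AG_mean n (fun t => f t + g t) = AG_mean n f + AG_mean n g.
Proof. by rewrite /AG_mean -big_split; apply: eq_bigr => q _; rewrite mulrDr. Qed.

Lemma AG_meanZ n c f : AG_mean n (fun t => c * f t) = c * AG_mean n f.
Proof. by rewrite /AG_mean mulr_sumr; apply: eq_bigr => q _; rewrite mulrCA. Qed.

(** The total weight of a tree with [n] leaves is [n - alpha], whatever its shape,
    so the normalisation of one growth step comes out of the mean. For [n = 1] both
    sides are consistent with the prescribed T_2, since the single edge of T_1 has
    weight [1 - alpha]. *)
Lemma AG_mean_growth n f : (0 < n)%N ->
  (n%:R - alpha) * AG_mean n.+1 f = AG_mean n (tree_growth f).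
Proof.
case: n => [//|[|n]] _.
  by rewrite /AG_mean /= !big_seq1 !mul1r /tree_growth /= big_seq1.
rewrite /AG_mean [AG_dist p n.+3]/= big_allpairs_dep mulr_sumr.
rewrite big_seq [RHS]big_seq; apply: eq_bigr => q qn.
have [_ q2 _] := AG_dist_leaves (isT : (0 < n.+2)%N) qn.
have nz := alpha_lt (isT : (1 < n.+2)%N).
rewrite growth_weight q2 /tree_growth !mulr_sumr; apply: eq_bigr => x _ /=.
have {}nz : n.+2%:R - ag_alpha p != 0 by rewrite gt_eqF.
rewrite -/alpha in nz *; move: (n.+2%:R - alpha) nz => w w0.
by field.
Qed.

Lemma forest_growth_cons phi c s : forest_growth phi (c :: s) =
  tree_growth (fun c' => phi (c' :: s)) c + forest_growth (fun s' => phi (c :: s')) s.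
Proof. by rewrite /forest_growth /= big_cat !big_map. Qed.

(** The three terms are the insertion on the phantom edge, after which the whole
    tree is the first child and has a leaf as its only sibling, the insertions at
    the root and among the siblings, and the insertions in the first child. *)
Lemma tree_growth_split phi h b s :
  tree_growth (root_split phi h) (FNode (b :: s)) =
  gamma * phi [:: fleaf] * h (FNode (b :: s)) + sibling_growth phi s * h b
  + phi s * tree_growth h b.
Proof.
rewrite /tree_growth [growth p _]/= 2!big_cons big_map /=.
have -> : \sum_(j <- growth_forest (growth p) (b :: s))
    j.1 * root_split phi h (FNode j.2) =
  forest_growth (fun s => root_split phi h (FNode s)) (b :: s) by [].
rewrite forest_growth_cons /= /sibling_growth -[(size s).+1]addn1 natrD addrK.
have -> : tree_growth (fun c' => phi s * h c') b = phi s * tree_growth h b.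
  by rewrite /tree_growth mulr_sumr; apply: eq_bigr => x _; rewrite mulrCA.
have -> : forest_growth (fun s' => phi s' * h b) s = forest_growth phi s * h b.
  by rewrite /forest_growth mulr_suml; apply: eq_bigr => x _; rewrite mulrA.
by rewrite -/alpha -/gamma -/(tree_growth h b); ring.
Qed.

(** The number of trees in the forest is carried along to rule out that an insertion
    turns an inner vertex into a leaf. *)
Lemma growth_leaves t x : x \in growth p t -> nleaves x.2 = (nleaves t).+1.
Proof.
move: t x; apply: (@ftree_ind2 _ (fun s => forall x,
   x \in growth_forest (growth p) s ->
   size x.2 = size s /\ forest_leaves x.2 = (forest_leaves s).+1)) => //.
- move=> c s cP sP x /=; rewrite mem_cat => /orP[] /mapP[y yP ->] /=.
    by rewrite /forest_leaves/= (cP _ yP).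
  have [-> h] := sP _ yP; split => //.
  by rewrite /forest_leaves/= -!/(forest_leaves _) h addnS.
- move=> s sP x; rewrite [growth p _]/= inE mem_cat => /orP[/eqP->|/orP[]].
  + by rewrite /= addn0 addn1.
  + case: s {sP} => [//|c s]; rewrite inE => /eqP -> /=.
    by rewrite map_rcons sumn_rcons addnA addn1.
  + move=> /mapP[y /sP[ys yl] ->] /=; move: ys yl; rewrite /forest_leaves.
    by case: (y.2) => [|? ?]; case: (s) => [|? ?].
Qed.

Lemma forest_growth_leaves s x : x \in growth_forest (growth p) s ->
  forest_leaves x.2 = (forest_leaves s).+1.
Proof.
elim: s x => [//|c s sP] x /=; rewrite mem_cat => /orP[] /mapP[y yP ->] /=.
  by rewrite /forest_leaves/= (growth_leaves yP).
by rewrite /forest_leaves/= -!/(forest_leaves _) (sP _ yP) addnS.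
Qed.

Lemma forest_leaves_rcons s c :
  forest_leaves (rcons s c) = (forest_leaves s + nleaves c)%N.
Proof. by rewrite /forest_leaves map_rcons sumn_rcons. Qed.

Lemma forest_growth_graded m phi :
  graded m.+1 phi -> graded m (forest_growth phi).
Proof.
move=> gphi s sm; rewrite /forest_growth big_seq big1// => x /forest_growth_leaves xs.
by rewrite gphi ?mulr0// xs eqSS.
Qed.

Lemma sibling_growth_graded m phi :
  graded m.+1 phi -> graded m (sibling_growth phi).
Proof.
move=> gphi s sm; rewrite /sibling_growth (forest_growth_graded gphi)// addr0.
by rewrite gphi ?mulr0// forest_leaves_rcons addn1 eqSS.
Qed.

Definition sibling_mean n phi : R := AG_mean n (root_split phi (fun=> 1)).

(** The first child has at least one leaf, and a root has at least two children, so
    the siblings have between [1] and [n - 1] leaves. *)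
Lemma root_split_small n m phi h : (0 < n)%N -> graded m phi ->
  (n <= m)%N || (m == 0)%N -> AG_mean n (root_split phi h) = 0.
Proof.
move=> n0 gphi nm; have <- : 0 * AG_mean n (fun=> 1) = 0 by rewrite mul0r.
rewrite -AG_meanZ; apply: eq_AG_mean => // -[[|b s]] //= tn.
  by rewrite mul0r.
move=> /andP[s1 _]; rewrite gphi ?mul0r//; apply: contraL nm.
move: tn; rewrite -/(forest_leaves s) => tn /eqP sm; rewrite negb_or.
have := nleaves_gt0 b; have := size_forest_leaves s.
by case: (size s) s1 => //= k _ ; lia.
Qed.

Lemma AG_mean_split_growth n phi h : (1 < n)%N ->
  (n%:R - alpha) * AG_mean n.+1 (root_split phi h) =
  gamma * phi [:: fleaf] * AG_mean n h + AG_mean n (root_split (sibling_growth phi) h)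
  + AG_mean n (root_split phi (tree_growth h)).
Proof.
move=> n1; rewrite AG_mean_growth; last exact: ltnW.
rewrite -AG_meanZ -!AG_meanD; apply: eq_AG_mean; first exact: ltnW.
move=> -[[|b s]] /=; first by move=> n1'; rewrite -n1' in n1.
by move=> _ _; rewrite tree_growth_split.
Qed.

(** Markov branching at the first child. Each of the three ways of growing preserves
    the property: on the phantom edge the new first child is T_n itself, with one
    leaf beside it; among the siblings the first child is untouched; and the first
    child, once chosen, grows with total weight [n - m - alpha], that is, as an
    alpha-gamma tree of its own. Induction on [n], for all [m], [phi] and [h]. *)
Lemma AG_mean_split n m phi h : (1 < n)%N -> graded m phi ->
  AG_mean n (root_split phi h) = sibling_mean n phi * AG_mean (n - m) h.
Proof.
move=> n1; elim: n n1 m phi h => [//|n IHn] n1 m phi h gphi.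
have [nm|] := boolP ((n.+1 <= m)%N || (m == 0)%N).
  by rewrite /sibling_mean !(@root_split_small _ m)// mul0r.
rewrite negb_or -ltnNge ltnS -lt0n => /andP[mn m0].
case: m m0 mn gphi => [//|m] _ mn gphi.
have [n2|n2] := leqP n 1.
  have {}n2 : n = 1%N by lia.
  have {}mn : m = 0%N by lia.
  subst n m; rewrite /sibling_mean /AG_mean /= !big_seq1 /=.
  by rewrite !mul1r mulr1.
have nz := alpha_lt n2.
have {}nz : n%:R - alpha != 0 by rewrite gt_eqF.
apply: (mulfI nz); rewrite mulrA /sibling_mean !AG_mean_split_growth//.
rewrite !mulrDl; congr (_ + _ + _).
- rewrite AG_mean1 mulr1; case: m gphi mn => [|m] gphi mn; first by rewrite subSS subn0.
  by rewrite gphi ?mulr0 ?mul0r.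
- case: m gphi mn => [|m] gphi mn.
    by rewrite !(@root_split_small _ 0) ?mul0r ?(ltnW n2) ?orbT//; exact: sibling_growth_graded.
  by rewrite (IHn _ m.+1)//; exact: sibling_growth_graded.
- have [nm|nm] := leqP n m.+1.
    by rewrite !(@root_split_small _ m.+1) ?mul0r ?(ltnW n2) ?nm//.
  rewrite !(IHn n2 m.+1)// -!AG_mean_growth ?subn_gt0//.
  by rewrite AG_mean1 -subSn // subSS; ring.
Qed.

Lemma sibling_mean_rec n m phi : (1 < n)%N -> (m < n)%N -> graded m phi ->
  (n%:R - alpha) * sibling_mean n.+1 phi = ((n - m)%:R - alpha) * sibling_mean n phi
    + (gamma * phi [:: fleaf] + sibling_mean n (sibling_growth phi)).
Proof.
move=> n1 mn gphi; rewrite /sibling_mean AG_mean_split_growth// AG_mean1 mulr1.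
rewrite (@AG_mean_split n m phi (tree_growth _))// -AG_mean_growth ?subn_gt0//.
by rewrite AG_mean1 mulr1 /sibling_mean; ring.
Qed.

End growth.

(** * The limiting law of the small subtrees at the root *)

(** The distance of [x n] to [l] is contracted by the factor
    [1 - m / (n - a) <= 1 - 1 / n], up to an error of relative size [m / (n - a)]
    which only matters at the scale of the error on [b]. The products of these
    factors tend to [0]; they telescope once written as
    [n * y n.+1 <= (n - 1) * y n]. *)
Lemma cvg_relaxation (R : realType) (a l : R) (m : nat) (x b : nat -> R) :
  0 <= a -> a <= 1 -> (0 < m)%N ->
  (forall n, (m < n)%N ->
     (n%:R - a) * x n.+1 = ((n - m)%:R - a) * x n + b n) ->
  b n @[n --> \oo] --> m%:R * l -> x n @[n --> \oo] --> l.
Proof.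
move=> a0 a1 m0 xrec bl; apply/cvgrPdist_le => e e0.
have me0 : 0 < m%:R * (e / 2) :> R by rewrite mulr_gt0// ?ltr0n// divr_gt0.
have /cvgrPdist_le/(_ _ me0)[N _ bN] := bl.
pose k := (maxn N m).+1.
(* The part of the distance that exceeds half of the target accuracy. *)
pose y n := Num.max 0 (`|x n - l| - e / 2).
have y0 n : 0 <= y n by rewrite le_max lexx.
have yrec n : (k <= n)%N -> n%:R * y n.+1 <= (n%:R - 1) * y n.
  move=> kn; have [nN mn] : (N <= n)%N /\ (m < n)%N by rewrite /k in kn; lia.
  have m1 : 1 <= m%:R :> R by rewrite ler1n.
  have n1 : 1 <= n%:R :> R by rewrite ler1n; lia.
  have na : 0 < n%:R - a.
    by rewrite subr_gt0 (le_lt_trans a1)// ltr1n; lia.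
  have nmE : (n - m)%:R = n%:R - m%:R :> R by rewrite natrB// ltnW.
  have nma : 0 <= n%:R - m%:R - a.
    by rewrite -nmE subr_ge0 (le_trans a1)// ler1n; lia.
  have eqn : (n%:R - a) * (x n.+1 - l) =
      (n%:R - m%:R - a) * (x n - l) + (b n - m%:R * l).
    by rewrite mulrBr xrec// nmE; ring.
  have h1 : (n%:R - a) * (`|x n.+1 - l| - e / 2) <=
      (n%:R - m%:R - a) * (`|x n - l| - e / 2).
    have := ler_normD ((n%:R - m%:R - a) * (x n - l)) (b n - m%:R * l).
    rewrite -eqn !normrM (gtr0_norm na) (ger0_norm nma).
    by have := bN n nN; rewrite distrC /= => b2 b1; lra.
  have h2 : (n%:R - a) * y n.+1 <= (n%:R - 1 - a) * y n.
    apply: (@le_trans _ _ ((n%:R - m%:R - a) * y n)); last first.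
      by rewrite ler_wpM2r//; lra.
    have [-> |->] : y n.+1 = 0 \/ y n.+1 = `|x n.+1 - l| - e / 2.
      by rewrite /y /Num.max; case: ifP => _; [right|left].
      by rewrite mulr0 mulr_ge0.
    by apply: (le_trans h1); rewrite ler_wpM2l// le_max lexx orbT.
  rewrite -(ler_pM2l na) mulrCA.
  apply: (@le_trans _ _ (n%:R * ((n%:R - 1 - a) * y n))).
    by rewrite ler_wpM2l// ?(le_trans ler01).
  rewrite -subr_ge0 (_ : _ - _ = a * y n); last by ring.
  exact: mulr_ge0.
have ybnd n : (k <= n)%N -> (n%:R - 1) * y n <= (k%:R - 1) * y k.
  elim: n => [|n IH]; first by rewrite leqn0 => /eqP ->.
  rewrite leq_eqVlt => /predU1P[->//|]; rewrite ltnS => kn.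
  by rewrite -natr1 addrK (le_trans (yrec _ kn))// IH.
pose C := (k%:R - 1) * y k.
exists (k + (Num.bound (C / (e / 2))).+2)%N => // n /= kn.
have e20 : 0 < e / 2 by rewrite divr_gt0.
have Cn : C < (n%:R - 1) * (e / 2).
  rewrite -ltr_pdivrMr//.
  have k0 : 0 <= k%:R - 1 :> R by rewrite subr_ge0 ler1n.
  have C0 : 0 <= C by exact: mulr_ge0.
  apply: lt_le_trans (archi_boundP _) _; first by rewrite divr_ge0// ltW.
  rewrite lerBrDr natr1 ler_nat (leq_trans _ kn)//.
  by rewrite !addnS ltnS; apply: leqW; exact: leq_addl.
have n1 : 0 < n%:R - 1 :> R.
  by rewrite subr_gt0 ltr1n (leq_trans _ kn)// !addnS !ltnS.
have : y n <= e / 2.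
  rewrite -(ler_pM2l n1); apply: (le_trans (ybnd _ (leq_trans (leq_addr _ _) kn))).
  exact: ltW.
by rewrite ge_max => /andP[_]; rewrite distrC; lra.
Qed.

(** A bush is one of the finite trees hanging from the infinite branch. Here [b l] is
    the probability that it has [l + 1] leaves and [rho j] the probability that
    there are [j + 1] bushes at a vertex; only the recursions satisfied by these two
    sequences enter the identification of the limit. *)
Section limit_functional.
Context {R : realType} (p : AG_param R).
Let alpha := ag_alpha p.
Let gamma := ag_gamma p.
Variables (b rho : nat -> R).
Hypothesis b0 : b 0 = alpha.
Hypothesis bS : forall l, l.+2%:R * b l.+1 = (l.+1%:R - alpha) * b l.
Hypothesis rho0 : alpha * rho 0 = gamma.
Hypothesis rhoS : forall j, alpha * (j.+2%:R * rho j.+1) = (j.+1%:R * alpha - gamma) * rho j.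
Variable M : nat.

(** Means over the law of a bush, of [j] independent bushes, and of all the bushes at
    a vertex. The cutoff [M] makes all sums finite and is harmless on functions that
    vanish on forests with more than [M] leaves. *)
Definition bush_mean (f : ftree -> R) : R := \sum_(l < M) b l * AG_mean p l.+1 f.

Fixpoint bushes_mean j (phi : seq ftree -> R) : R :=
  if j is j'.+1 then bush_mean (fun t => bushes_mean j' (fun s => phi (t :: s)))
  else phi [::].

Definition siblings_mean (phi : seq ftree -> R) : R :=
  \sum_(j < M) rho j * bushes_mean j.+1 phi.

Lemma bush_meanD f g : bush_mean (fun t => f t + g t) = bush_mean f + bush_mean g.
Proof.
rewrite /bush_mean -big_split; apply: eq_bigr => l _.
by rewrite AG_meanD mulrDr.
Qed.

Lemma bush_meanZ c f : bush_mean (fun t => c * f t) = c * bush_mean f.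
Proof.
rewrite /bush_mean mulr_sumr; apply: eq_bigr => l _.
by rewrite AG_meanZ mulrCA.
Qed.

Lemma eq_bush_mean f g : f =1 g -> bush_mean f = bush_mean g.
Proof. by move=> /funext ->. Qed.

Lemma eq_bushes_mean j phi psi : phi =1 psi -> bushes_mean j phi = bushes_mean j psi.
Proof. by move=> /funext ->. Qed.

Lemma eq_bushes_mean_size j phi psi :
  (forall s, size s = j -> phi s = psi s) -> bushes_mean j phi = bushes_mean j psi.
Proof.
elim: j phi psi => [|j IH] phi psi h /=; first exact: h.
by apply: eq_bush_mean => t; apply: IH => s sj; apply: h; rewrite /= sj.
Qed.

Lemma bushes_meanD j phi psi :
  bushes_mean j (fun s => phi s + psi s) = bushes_mean j phi + bushes_mean j psi.
Proof.
elim: j phi psi => //= j IH phi psi.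
by rewrite -bush_meanD; apply: eq_bush_mean => t; rewrite IH.
Qed.

Lemma bushes_meanZ j c phi :
  bushes_mean j (fun s => c * phi s) = c * bushes_mean j phi.
Proof.
elim: j phi => //= j IH phi.
by rewrite -bush_meanZ; apply: eq_bush_mean => t; rewrite IH.
Qed.

Lemma bushes_mean0 j : bushes_mean j (fun=> 0) = 0.
Proof.
rewrite -[RHS](mul0r (bushes_mean j (fun=> 0))) -bushes_meanZ.
by apply: eq_bushes_mean => s; rewrite mul0r.
Qed.

Lemma bushes_mean_sum (I : Type) (r : seq I) j (phi : I -> seq ftree -> R) :
  bushes_mean j (fun s => \sum_(i <- r) phi i s) = \sum_(i <- r) bushes_mean j (phi i).
Proof.
elim: r => [|i r IH].
  by rewrite big_nil -[RHS](bushes_mean0 j); apply: eq_bushes_mean => s; rewrite big_nil.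
rewrite big_cons -IH -bushes_meanD.
by apply: eq_bushes_mean => s; rewrite big_cons.
Qed.

(** Size biasing a bush amounts to letting it grow: since
    [(l + 2) * b l.+1 = (l + 1 - alpha) * b l], the bush with [l + 2] leaves, weighted
    by its number of leaves, is the bush with [l + 1] leaves after an insertion. The
    term [l = 0], a single leaf, is left over. *)
Lemma bush_mean_nleaves f : (forall t, (M < nleaves t)%N -> f t = 0) ->
  bush_mean (fun t => (nleaves t)%:R * f t) =
  alpha * f fleaf + bush_mean (tree_growth p f).
Proof.
move=> f0.
(* [T l] is the contribution of the bushes with [l + 1] leaves. *)
pose T l := l.+1%:R * (b l * AG_mean p l.+1 f).
have -> : bush_mean (fun t => (nleaves t)%:R * f t) = \sum_(l < M) T l.
  apply: eq_bigr => l _; rewrite /T mulrCA; congr (_ * _).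
  by rewrite -AG_meanZ; apply: eq_AG_mean => // t ->.
have -> : bush_mean (tree_growth p f) = \sum_(l < M) T l.+1.
  apply: eq_bigr => l _; rewrite /T -AG_mean_growth//.
  by rewrite [RHS]mulrA bS -/alpha; ring.
have -> : alpha * f fleaf = T 0.
  by rewrite /T /AG_mean b0 /= big_seq1 !mul1r.
transitivity (\sum_(l < M.+1) T l); last by rewrite big_ord_recl.
rewrite big_ord_recr /= [T M](_ : _ = 0) ?addr0//.
rewrite /T (_ : AG_mean _ _ _ = 0) ?mulr0//.
rewrite -[RHS](mul0r (AG_mean p M.+1 f)) -AG_meanZ; apply: eq_AG_mean => // t tM _.
by rewrite f0 ?mul0r// tM.
Qed.

Definition perm_invariant (phi : seq ftree -> R) :=
  forall s s', perm_eq s s' -> phi s = phi s'.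

Lemma perm_invariant_cons phi c :
  perm_invariant phi -> perm_invariant (fun s => phi (c :: s)).
Proof. by move=> sphi s s' ss'; apply: sphi; rewrite perm_cons. Qed.

(** [bush_mean_nleaves] for each of the [j] bushes in turn. Invariance under
    permutations makes the [j] terms where a bush is a single leaf equal. *)
Lemma bushes_mean_leaves j phi : perm_invariant phi ->
  (forall s, (M < forest_leaves s)%N -> phi s = 0) ->
  bushes_mean j (fun s => (forest_leaves s)%:R * phi s) =
  bushes_mean j (forest_growth p phi) +
  alpha * (j%:R * bushes_mean j.-1 (fun s => phi (fleaf :: s))).
Proof.
elim: j phi => [|j IH] phi sphi bphi.
  by rewrite /= /forest_growth /= big_nil /forest_leaves/= !mul0r mulr0 addr0.
rewrite [LHS]/=.
have bphi' t s : (M < forest_leaves s)%N -> phi (t :: s) = 0.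
  by move=> h; apply: bphi; rewrite /forest_leaves /= (leq_trans h)// leq_addl.
under eq_bush_mean => t.
  rewrite (@eq_bushes_mean j _ (fun s => (nleaves t)%:R * phi (t :: s) +
      (forest_leaves s)%:R * phi (t :: s))); last first.
    by move=> s; rewrite /forest_leaves /= natrD mulrDl.
  rewrite bushes_meanD bushes_meanZ (IH (fun s => phi (t :: s))); last 2 first.
  - exact: perm_invariant_cons.
  - exact: bphi'.
  over.
rewrite bush_meanD bush_mean_nleaves; last first.
  move=> t tM; rewrite -[RHS](bushes_mean0 j); apply: eq_bushes_mean => s.
  by rewrite bphi// /forest_leaves /= (leq_trans tM)// leq_addr.
rewrite bush_meanD bush_meanZ bush_meanZ.
have -> : j%:R * bush_mean (fun t => bushes_mean j.-1 (fun s => phi [:: t, fleaf & s])) =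
    j%:R * bushes_mean j (fun s => phi (fleaf :: s)).
  case: j {IH} => [|j] /=; first by rewrite !mul0r.
  congr (_ * _); apply: eq_bush_mean => t; apply: eq_bushes_mean => s.
  by apply: sphi; apply/permEl; exact: (perm_catCA [:: t] [:: fleaf] s).
have -> : bushes_mean j.+1 (forest_growth p phi) =
   bush_mean (tree_growth p (fun t => bushes_mean j (fun s => phi (t :: s)))) +
   bush_mean (fun t => bushes_mean j (forest_growth p (fun s => phi (t :: s)))).
  rewrite -bush_meanD /=; apply: eq_bush_mean => t.
  rewrite /tree_growth -[X in X + _](_ : bushes_mean j (fun s =>
     \sum_(x <- growth p t) x.1 * phi (x.2 :: s)) = _); last first.
    by rewrite bushes_mean_sum; apply: eq_bigr => x _; rewrite bushes_meanZ.
  rewrite -bushes_meanD; apply: eq_bushes_mean => s.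
  by rewrite forest_growth_cons.
by rewrite /= -[j.+1%:R]natr1; ring.
Qed.

(** The number of leaves being equal to [m] where [phi] does not vanish, this is
    [bushes_mean_leaves] summed over the number of bushes. The leftover term with
    [j + 2] bushes, one of which is a leaf, compensates the insertion of a leaf at
    a root with [j + 1] bushes, thanks to the recursion for [rho]; the one with a
    single bush gives [gamma * phi [:: fleaf]]. *)
Lemma siblings_mean_rec m phi : perm_invariant phi -> graded m phi -> (m <= M)%N ->
  m%:R * siblings_mean phi =
  gamma * phi [:: fleaf] + siblings_mean (sibling_growth p phi).
Proof.
move=> sphi gphi mM.
have bphi s : (M < forest_leaves s)%N -> phi s = 0.
  by move=> h; rewrite gphi// gtn_eqF// (leq_ltn_trans mM).
pose T j := alpha * (j.+1%:R * rho j) * bushes_mean j (fun s => phi (fleaf :: s)).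
have -> : m%:R * siblings_mean phi =
    \sum_(j < M) rho j * bushes_mean j.+1 (forest_growth p phi) + \sum_(j < M) T j.
  rewrite /siblings_mean mulr_sumr -big_split; apply: eq_bigr => j _.
  have -> : m%:R * (rho j * bushes_mean j.+1 phi) =
      rho j * bushes_mean j.+1 (fun s => (forest_leaves s)%:R * phi s).
    rewrite mulrCA -(bushes_meanZ _ m%:R); congr (_ * _); apply: eq_bushes_mean => s.
    have [<-//|sm] := eqVneq (forest_leaves s) m.
    by rewrite (gphi s sm) !mulr0.
  by rewrite bushes_mean_leaves// mulrDr /T /=; congr (_ + _); ring.
have -> : siblings_mean (sibling_growth p phi) =
    \sum_(j < M) rho j * bushes_mean j.+1 (forest_growth p phi) + \sum_(j < M) T j.+1.
  rewrite /siblings_mean -big_split; apply: eq_bigr => j _.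
  rewrite /T rhoS -/alpha -/gamma.
  have -> : bushes_mean j.+1 (sibling_growth p phi) =
      bushes_mean j.+1 (forest_growth p phi) +
      (j.+1%:R * alpha - gamma) * bushes_mean j.+1 (fun s => phi (fleaf :: s)).
    rewrite -bushes_meanZ -bushes_meanD; apply: eq_bushes_mean_size => s sj.
    by rewrite /sibling_growth sj addrC (sphi (rcons s fleaf) (fleaf :: s))// perm_rcons.
  by rewrite mulrDr; congr (_ + _); rewrite mulrA [rho j * _]mulrC.
have T0 : T 0 = gamma * phi [:: fleaf] by rewrite /T mul1r rho0.
have TM : T M = 0.
  rewrite /T (_ : bushes_mean _ _ = 0) ?mulr0//.
  rewrite -[RHS](bushes_mean0 M); apply: eq_bushes_mean_size => s sM.
  by rewrite bphi// (leq_trans _ (size_forest_leaves _))//= sM.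
rewrite addrCA; congr (_ + _); rewrite -T0.
transitivity (\sum_(j < M.+1) T j); last by rewrite big_ord_recl.
by rewrite big_ord_recr /= TM addr0.
Qed.

(** [forest_growth] lists the insertions from left to right; up to permutations, the
    tree that grows can always be moved to the front, which makes the symmetry of
    the sum visible. *)
Lemma forest_growth_rem phi s : perm_invariant phi ->
  forest_growth p phi s =
  \sum_(c <- s) tree_growth p (fun c' => phi (c' :: rem c s)) c.
Proof.
elim: s phi => [|c s IH] phi sphi; first by rewrite /forest_growth /= !big_nil.
rewrite forest_growth_cons big_cons IH; last exact: perm_invariant_cons.
congr (_ + _); first by rewrite /= eqxx.
rewrite big_seq [RHS]big_seq; apply: eq_bigr => d ds.
congr tree_growth; apply/funext => d'; apply: sphi.
apply/(perm_trans (permEl (perm_catCA [:: c] [:: d'] (rem d s)))).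
rewrite perm_cons /=; case: eqVneq => [->|_]; last exact: perm_refl.
by rewrite perm_sym perm_to_rem.
Qed.

Lemma sibling_growth_perm phi :
  perm_invariant phi -> perm_invariant (sibling_growth p phi).
Proof.
move=> sphi s s' ss'; rewrite /sibling_growth (perm_size ss').
congr (_ * _ + _).
  by apply: sphi; rewrite -!cats1 perm_cat2r.
rewrite !forest_growth_rem// (perm_big _ ss') /= big_seq [RHS]big_seq.
apply: eq_bigr => c cs; congr tree_growth; apply/funext => c'; apply: sphi.
rewrite perm_cons -(perm_cons c); apply: perm_trans (perm_to_rem cs).
by rewrite (perm_trans _ ss')// perm_sym perm_to_rem// (perm_mem ss').
Qed.

(** The sequence [sibling_mean p n phi] relaxes to [siblings_mean phi], because the
    latter is the stationary solution of [sibling_mean_rec] whose source term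
    converges by the induction hypothesis. *)
Lemma cvg_sibling_mean m phi : (m <= M)%N -> perm_invariant phi -> graded m phi ->
  sibling_mean p n phi @[n --> \oo] --> siblings_mean phi.
Proof.
elim: m phi => [|m IH] phi mM sphi gphi.
  have -> : siblings_mean phi = 0.
    rewrite /siblings_mean big1// => j _.
    rewrite (@eq_bushes_mean_size _ _ (fun=> 0)) ?bushes_mean0 ?mulr0// => s sj.
    by rewrite gphi// -lt0n; apply: leq_trans (size_forest_leaves s); rewrite sj.
  apply: cvg_near_cst; near=> n; rewrite /sibling_mean (@root_split_small _ _ _ 0)//.
    by near: n; exists 1%N.
  by rewrite orbT.
apply: (@cvg_relaxation _ alpha _ m.+1 _
  (fun n => gamma * phi [:: fleaf] + sibling_mean p n (sibling_growth p phi))) => //.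
- exact: le_trans (ag_gamma_ge0 p) (ag_gamma_le p).
- exact: ag_alpha_le1.
- move=> n mn; apply: sibling_mean_rec => //; exact: leq_ltn_trans mn.
- rewrite (siblings_mean_rec sphi gphi mM).
  apply: cvgD; first exact: cvg_cst.
  apply: IH; first exact: ltnW.
    exact: sibling_growth_perm.
  exact: sibling_growth_graded.
Unshelve. all: by end_near. Qed.

End limit_functional.

(** * The Gamma function and the beta geometric law *)

Section gamma_function.
Context {R : realType}.
Notation mu := (@lebesgue_measure R).

Lemma derivable_oo_LRcontinuous_gt0 (F : R -> R) (a b : R) : 0 < a -> a < b ->
  (forall x : R, 0 < x -> derivable F x 1) -> derivable_oo_LRcontinuous F a b.
Proof.
move=> a0 ab dF.
have cF (x : R) : 0 < x -> F z @[z --> x] --> F x.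
  by move=> x0; apply/differentiable_continuous/derivable1_diffP/dF.
split.
- by move=> x; rewrite in_itv/= => /andP[ax _]; apply: dF; exact: lt_trans ax.
- exact/cvg_at_right_filter/cF.
- by apply/cvg_at_left_filter/cF; exact: lt_trans ab.
Qed.

Let N_expRN (t : R) := - expR (- t).

Let is_derive_N_expRN (t : R) : is_derive t 1 N_expRN (expR (- t)).
Proof.
have h : is_derive t 1 (fun t : R => expR (- t)) (- expR (- t)).
  by apply: is_derive_eq; rewrite /GRing.scale/= mulrN1.
by apply: is_derive_eq; rewrite opprK.
Qed.

Lemma Gamma_parts (x a b : R) : 0 < x -> 0 < a -> a < b ->
  (\int[mu]_(t in `[a, b]) (t `^ x * expR (- t))%:E =
  (a `^ x * expR (- a) - b `^ x * expR (- b))%:E +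
  x%:E * \int[mu]_(t in `[a, b]) (t `^ (x - 1) * expR (- t))%:E)%E.
Proof.
move=> x0 a0 ab.
have pos (t : R) : t \in `]a, b[ -> 0 < t.
  by rewrite in_itv/= => /andP[at_ _]; exact: lt_trans at_.
have posc (t : R) : t \in `[a, b] -> 0 < t.
  by rewrite in_itv/= => /andP[at_ _]; exact: lt_le_trans at_.
have dpow (y t : R) : 0 < t -> derivable (fun s : R => s `^ y) t 1.
  by move=> t0; apply: derivable_powR; rewrite in_itv/= t0.
have dexp (t : R) : derivable (fun t => expR (- t)) t 1 by [].
rewrite (@integration_by_parts R (fun t => t `^ x) N_expRN
  (fun t => x * t `^ (x - 1)) (fun t => expR (- t)) a b ab).
- have -> : (\int[mu]_(t in `[a, b]) (x * t `^ (x - 1) * N_expRN t)%:E =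
     - (x%:E * \int[mu]_(t in `[a, b]) (t `^ (x - 1) * expR (- t))%:E))%E.
    rewrite -mulNe -EFinN -integralZl//.
    + by apply: eq_integral => t _; rewrite -EFinM /N_expRN; congr EFin; ring.
    + apply: continuous_compact_integrable => //; first exact: segment_compact.
      apply: derivable_within_continuous => t /posc t0.
      by apply: derivableM => //; exact: dpow.
  rewrite oppeK; congr (_ + _)%E; congr EFin; rewrite /N_expRN; ring.
- apply: derivable_within_continuous => t /posc t0.
  by apply: derivableM => //; exact: dpow.
- by apply: derivable_oo_LRcontinuous_gt0 => // t; exact: dpow.
- by move=> t /pos t0; apply: powR_derive1; rewrite in_itv/= t0.
- by apply: derivable_within_continuous => t _.
- by apply: derivable_oo_LRcontinuous_gt0.
- by move=> t _; rewrite derive1E; have [_ ->] := is_derive_N_expRN t.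
Qed.

(** The exponential dominates its Taylor term of degree [k + 1], for an integer
    [k >= x]. *)
Lemma powR_expRN_cvg0 (x : R) : 0 < x ->
  n.+2%:R `^ x * expR (- n.+2%:R) @[n --> \oo] --> (0 : R).
Proof.
move=> x0.
pose k := Num.bound x.
have xk : x <= k%:R by rewrite ltW// archi_boundP// ltW.
apply: (@squeeze_cvgr _ _ _ _ (fun=> 0) (fun n => (k.+1)`!%:R * harmonic n)).
- near=> n; apply/andP; split.
    by rewrite mulr_ge0// ?powR_ge0 ?expR_ge0.
  have n0 : 0 < n.+2%:R :> R by rewrite ltr0n.
  have kf : 0 < (k.+1)`!%:R :> R by rewrite ltr0n fact_gt0.
  have h1 : n.+2%:R `^ x <= n.+2%:R ^+ k :> R.
    by rewrite -powR_mulrn ?(ltW n0)// ler_powR// ler1n.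
  have h2 : n.+2%:R ^+ k.+1 / (k.+1)`!%:R <= expR (n.+2%:R : R).
    have := @expR_ge1Dxn _ (n.+2%:R : R) k (ltW n0); apply: le_trans.
    by rewrite lerDr.
  apply: (@le_trans _ _ ((k.+1)`!%:R * n.+2%:R^-1)); last first.
    rewrite ler_pM2l// /harmonic lef_pV2 ?posrE ?ltr0n//.
    by rewrite ler_nat.
  rewrite expRN ler_pdivrMr ?expR_gt0//; apply: (le_trans h1).
  rewrite -mulrA mulrCA ler_pdivlMl// -ler_pdivrMl//.
  by rewrite mulrC -exprS.
- exact: cvg_cst.
- rewrite -[X in _ --> X](mulr0 (k.+1)`!%:R); apply: cvgMl_tmp.
  exact: cvg_harmonic.
Unshelve. all: by end_near.
Qed.

Lemma powR_expRN_cvg0_at0 (x : R) : 0 < x ->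
  n.+2%:R^-1 `^ x * expR (- n.+2%:R^-1) @[n --> \oo] --> (0 : R).
Proof.
move=> x0; apply: (@squeeze_cvgr _ _ _ _ (fun=> 0) (fun n => n.+2%:R^-1 `^ x)).
- near=> n; have e1 : expR (- (n.+2%:R : R)^-1) <= 1.
    by rewrite expR_le1 oppr_le0 invr_ge0.
  by rewrite mulr_ge0 ?powR_ge0 ?expR_ge0//= ler_piMr ?powR_ge0.
- exact: cvg_cst.
- have /cvg_at_rightP := powR_cvg0 x0; apply; split => [n|].
    by rewrite invr_gt0.
  by have := @cvg_harmonic R; rewrite -(cvg_shiftS (@harmonic R)).
Unshelve. all: by end_near.
Qed.

Let gamma_integral (x : R) : \bar R :=
  (\int[mu]_(t in `]0%R, +oo[) (t `^ (x - 1) * expR (- t))%:E)%E.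

(** Integrating by parts on these intervals avoids the singularity at [0]. *)
Let itv (n : nat) : set R := `[n.+2%:R^-1, n.+2%:R].

Lemma itv_gamma_integral (x : R) :
  (\int[mu]_(t in itv n) (t `^ (x - 1) * expR (- t))%:E @[n --> \oo] -->
   gamma_integral x)%E.
Proof.
have -> : gamma_integral x =
    (\int[mu]_(t in \bigcup_n itv n) (t `^ (x - 1) * expR (- t))%:E)%E.
  congr (integral _ _ _); apply/seteqP; split => [t|t [n _]] /=; last first.
    rewrite /itv /= !in_itv/= andbT => /andP[nt _]; apply: lt_le_trans nt.
    by rewrite invr_gt0.
  rewrite in_itv/= andbT => t0.
  exists (Num.bound t + Num.bound t^-1)%N => //=; rewrite /itv /= in_itv/=.
  have h1 := archi_boundP (ltW t0).
  have tV : 0 <= t^-1 by rewrite invr_ge0 ltW.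
  have h2 := archi_boundP tV.
  apply/andP; split.
    rewrite -[leRHS]invrK lef_pV2 ?posrE ?invr_gt0//.
    by rewrite (le_trans (ltW h2))// ler_nat -addnS -addnS; lia.
  by rewrite (le_trans (ltW h1))// ler_nat; lia.
apply: ge0_nondecreasing_set_cvg_integral.
- apply/nondecreasing_seqP => n; apply/subsetPset => t /=.
  rewrite /itv /= !in_itv/= => /andP[h1 h2]; apply/andP; split.
    by rewrite (le_trans _ h1)// lef_pV2 ?posrE// ler_nat.
  by rewrite (le_trans h2)// ler_nat.
- by move=> n; exact: measurable_itv.
- move=> n; apply/measurable_EFinP; apply: measurable_funM.
    by apply: measurable_funTS; exact: measurable_powR.
  apply: measurable_funTS; apply: measurableT_comp => //.
- by move=> n t _; rewrite lee_fin mulr_ge0 ?powR_ge0 ?expR_ge0.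
Qed.

(** The identity holds first between integrals in the extended reals, so that the
    convergence of the integrals need not be known: were one of them infinite, both
    would be, and both sides would be [0]. *)
Lemma GammaS (x : R) : 0 < x -> Gamma (x + 1) = x * Gamma x.
Proof.
move=> x0; have := @itv_gamma_integral (x + 1).
have lim : (\int[mu]_(t in itv n) (t `^ (x + 1 - 1) * expR (- t))%:E @[n --> \oo] -->
   0%:E + x%:E * gamma_integral x)%E.
  rewrite (_ : (fun n => _) = (fun n =>
    (n.+2%:R^-1 `^ x * expR (- n.+2%:R^-1) - n.+2%:R `^ x * expR (- n.+2%:R))%:E +
    x%:E * \int[mu]_(t in itv n) (t `^ (x - 1) * expR (- t))%:E)%E); last first.
    apply/funext => n; rewrite addrK; apply: Gamma_parts => //.
    rewrite (@lt_trans _ _ 1)// ?ltr1n// invf_lt1// ?ltr1n//.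
  apply: cvgeD => //.
    apply: cvg_EFin.
      by near=> n.
    rewrite -[X in _ --> X](subr0 0); apply: cvgB.
      exact: powR_expRN_cvg0_at0.
    exact: powR_expRN_cvg0.
  by apply: cvgeZl => //; exact: itv_gamma_integral.
move=> h0; have := @cvg_unique _ (@ereal_hausdorff R) _ _ _ _ lim h0.
rewrite add0e => h.
have {}h : fine (x%:E * gamma_integral x) = Gamma (x + 1) by rewrite h.
rewrite -h /Gamma /Rintegral -/(gamma_integral x).
case: (gamma_integral x) => [r| |] //=; first by rewrite mulr0 gt0_muley.
by rewrite mulr0 gt0_muleNy.
Unshelve. all: by end_near.
Qed.

End gamma_function.

Section beta_geometric.
Context {R : realType}.

Lemma beta_geometricS (theta : R) l : theta <= 1 ->
  l.+2%:R * beta_geometric theta l.+1 = (l.+1%:R - theta) * beta_geometric theta l.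
Proof.
rewrite /beta_geometric; case: eqVneq => [->|t1] tle1.
  by rewrite /= mulr0; case: l => [|l]; rewrite ?mulr0// subrr mul0r.
have lt1 : 0 < l.+1%:R - theta.
  by rewrite subr_gt0 (@lt_le_trans _ _ 1)// ?lt_neqAle ?t1// ler1n.
have -> : l.+1%:R + 1 - theta = (l.+1%:R - theta) + 1 by ring.
rewrite GammaS// natr1 (factS l.+1) natrM !invfM.
have l2 : l.+2%:R != 0 :> R by rewrite pnatr_eq0.
set x := _ - theta; set g := Gamma x; set g1 := (Gamma (1 - theta))^-1.
set f := ((l.+1)`!%:R)^-1.
transitivity (l.+2%:R / l.+2%:R * (x * (theta * g * (g1 * f)))); first by ring.
by rewrite divff// mul1r.
Qed.

(** The hypothesis forces [Gamma (1 - theta)] not to be [0]: otherwise all the masses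
    would be divisions by zero, hence [0]. It holds for the masses of a probability
    ([discrete_law_neq0]). *)
Lemma beta_geometric0 (theta : R) : (exists l, beta_geometric theta l != 0) ->
  beta_geometric theta 0 = theta.
Proof.
rewrite /beta_geometric; case: eqVneq => [->//|t1] [l].
have [->|g0 _] := eqVneq (Gamma (1 - theta)) 0; first by rewrite mul0r invr0 mulr0 eqxx.
by rewrite add0r factS fact0 mulr1; field.
Qed.

Lemma discrete_law_neq0 d (Omega : measurableType d) (P : probability Omega R)
    (X : {RV P >-> nat}) (q : nat -> R) :
  (forall l, P (X @^-1` [set l]) = (q l)%:E) -> exists l, q l != 0.
Proof.
move=> Xq; apply: contrapT => q0.
have {}q0 l : q l = 0 by apply/eqP; apply: contrapT => /negP ql; apply: q0; exists l.
have : P.-negligible (\bigcup_l X @^-1` [set l]).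
  apply: negligible_bigcup => l; exists (X @^-1` [set l]); split => //.
    by rewrite -[Z in measurable Z]setTI; exact: measurable_funP.
  by apply: etrans (Xq l) _; rewrite q0.
rewrite (_ : \bigcup_l _ = setT); last first.
  by apply/seteqP; split => // w _; exists (X w).
move=> /negligibleP /= => /(_ measurableT) /eqP.
by rewrite probability_setT eqe oner_eq0.
Qed.

End beta_geometric.

(** * Codes of finite pieces of the spine *)

(** A chosen arrangement of each multiset, so that multisets of siblings can be
    compared by equality. *)
Section canonical_order.
Context {T : choiceType}.

Definition perm_repr (s : seq T) : seq T := choose (perm_eq s) s.

Lemma perm_repr_perm s : perm_eq s (perm_repr s).
Proof. by apply: chooseP; exact: perm_refl. Qed.

Lemma perm_reprP s s' : reflect (perm_repr s = perm_repr s') (perm_eq s s').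
Proof.
apply: (iffP idP) => [ss'|e].
  rewrite /perm_repr (@eq_choose _ (perm_eq s') (perm_eq s)); last first.
    by move=> r; rewrite (permPl ss').
  by apply: choose_id => //; exact: perm_refl.
by rewrite (perm_trans (perm_repr_perm s))// e perm_sym perm_repr_perm.
Qed.

Definition arrangements (c : seq T) : seq (seq T) :=
  [seq s <- permutations c | perm_repr s == c].

Lemma mem_arrangements c s : (s \in arrangements c) = (perm_repr s == c).
Proof.
rewrite mem_filter mem_permutations; case: eqP => //= <-.
by rewrite perm_repr_perm.
Qed.

Lemma arrangements_uniq c : uniq (arrangements c).
Proof. by apply: filter_uniq; exact: permutations_uniq. Qed.

End canonical_order.

Section spine_code.
Context {R : realType} (p : AG_param R).

Definition fclass (t : ftree) : ltree R := tree_class (rtree_of t).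

Definition AG_support (n : nat) : seq (ltree R) := [seq fclass q.2 | q <- AG_dist p n].

(** Unordered trees are replaced by pairs of integers: the number [n] of leaves and the
    rank of the tree in the support of AG^n. This makes codes countable. A tree outside
    of the support gets the length of the list of the support as its rank. *)
Definition key (nt : nat * ltree R) : nat * nat := (nt.1, index nt.2 (AG_support nt.1)).

Definition fkey (t : ftree) : nat * nat := key (nleaves t, fclass t).

(** The multisets of siblings met while going up [n] times to the first child. *)
Fixpoint spine_code (n : nat) (t : ftree) : option (seq (seq (nat * nat))) :=
  if n is n'.+1 then
    if t is FNode (b :: s) then omap (cons (perm_repr (map fkey s))) (spine_code n' b) else None
  else Some [::].

Variables (b rho : nat -> R).

(** The probability that a bush has key [x]. *)
Definition key_mass (x : nat * nat) : R :=
  if x.1 is l.+1 then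
    b l * AG_mean p l.+1 (fun t => (key (l.+1, fclass t) == x)%:R)
  else 0.

Lemma bush_mean_fkey M x : (x.1 <= M)%N ->
  bush_mean p b M (fun t => (fkey t == x)%:R) = key_mass x.
Proof.
rewrite /bush_mean /key_mass.
have E l : AG_mean p l.+1 (fun t => (fkey t == x)%:R) =
    AG_mean p l.+1 (fun t => (key (l.+1, fclass t) == x)%:R).
  by apply: eq_AG_mean => // t tl _; rewrite /fkey tl.
have E0 l : l.+1 != x.1 -> AG_mean p l.+1 (fun t => (fkey t == x)%:R) = 0.
  move=> lx; rewrite -[RHS](mul0r (AG_mean p l.+1 (fun=> 1))) -AG_meanZ.
  apply: eq_AG_mean => // t tl _; rewrite mul0r /fkey /key tl /=.
  by case: eqP => // xE; rewrite -xE eqxx in lx.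
case xE : (x.1) => [|l] xM.
  by rewrite big1// => l _; rewrite E0 ?mulr0// xE.
rewrite (bigD1 (Ordinal xM))//= E big1 ?addr0// => l' l'l.
rewrite E0 ?mulr0// xE eqSS; apply: contraNneq l'l => l'l.
by apply/eqP/val_inj.
Qed.

Lemma bushes_mean_keys M j s : all (fun x => x.1 <= M)%N s ->
  bushes_mean p b M j (fun r => (map fkey r == s)%:R) =
  (size s == j)%:R * \prod_(x <- s) key_mass x.
Proof.
elim: j s => [|j IH] [|x s] /=; rewrite ?big_nil ?mulr1 ?mul0r//.
  move=> _; rewrite -[RHS](bushes_mean0 p b M j.+1).
  by apply: eq_bush_mean => t; exact: eq_bushes_mean.
move=> /andP[xM sM]; rewrite big_cons eqSS mulrCA -IH//.
rewrite -(bush_mean_fkey xM) mulrC -bush_meanZ.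
apply: eq_bush_mean => t; rewrite mulrC -bushes_meanZ; apply: eq_bushes_mean => r.
by rewrite eqseq_cons -natrM mulnb.
Qed.

(** The probability that the bushes at a vertex of the infinite branch, in their given
    order, have their list of keys in [S]. *)
Definition siblings_mass (S : seq (seq (nat * nat))) : R :=
  \sum_(s <- S) rho (size s).-1 * \prod_(x <- s) key_mass x.

Lemma siblings_mean_keys M S : uniq S ->
  all (fun s => [&& 0 < size s, size s <= M & all (fun x => x.1 <= M) s]%N) S ->
  siblings_mean p b rho M (fun r => (map fkey r \in S)%:R) = siblings_mass S.
Proof.
move=> uS SM; rewrite /siblings_mean.
have -> : (fun r => (map fkey r \in S)%:R : R) =
    (fun r => \sum_(s <- S) (map fkey r == s)%:R).
  apply/funext => r; elim: (S) uS => [|s S' IH] /=; first by rewrite big_nil.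
  move=> /andP[sS' uS']; rewrite big_cons -IH// inE.
  by case: eqVneq => [->|]; rewrite ?(negbTE sS') ?addr0 ?add0r.
under eq_bigr => j _ do rewrite bushes_mean_sum mulr_sumr.
rewrite exchange_big /siblings_mass big_seq [RHS]big_seq; apply: eq_bigr => s sS.
have /and3P[s0 sM allM] := allP SM _ sS.
have s1 : ((size s).-1 < M)%N by rewrite prednK.
under eq_bigr => j _ do rewrite bushes_mean_keys//.
rewrite (bigD1 (Ordinal s1))//= prednK// eqxx mul1r.
rewrite [X in _ + X]big1 ?addr0// => j js.
rewrite [_ == _](_ : _ = false) ?mul0r ?mulr0//.
apply: contraNF js => /eqP sj; apply/eqP/val_inj.
by rewrite /= sj.
Qed.

Hypothesis b0 : b 0 = ag_alpha p.
Hypothesis bS : forall l, l.+2%:R * b l.+1 = (l.+1%:R - ag_alpha p) * b l.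
Hypothesis rho0 : ag_alpha p * rho 0 = ag_gamma p.
Hypothesis rhoS : forall j,
  ag_alpha p * (j.+2%:R * rho j.+1) = (j.+1%:R * ag_alpha p - ag_gamma p) * rho j.

Definition code_mean n (D : seq (seq (nat * nat))) : R :=
  AG_mean p n (fun t => (spine_code (size D) t == Some D)%:R).

(** By [AG_mean_split] the siblings at the root and the rest of the code separate
    exactly, the latter being the code of a tree with [n - m] leaves, where [m] is
    the number of leaves that the code prescribes to the siblings. *)
Lemma cvg_code_mean D : [::] \notin D ->
  code_mean n D @[n --> \oo] --> \prod_(c <- D) siblings_mass (arrangements c).
Proof.
elim: D => [|c D IH].
  move=> _; rewrite big_nil /code_mean /= (_ : (fun n => _) = (fun=> 1)); last first.
    by apply/funext => n; rewrite -[RHS](AG_mean1 p n).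
  exact: cvg_cst.
rewrite inE negb_or eq_sym => /andP[c0 D0]; rewrite big_cons.
pose phi r : R := (map fkey r \in arrangements c)%:R.
pose h t : R := (spine_code (size D) t == Some D)%:R.
pose m := sumn (map fst c).
have gphi : graded m phi.
  move=> r rm; rewrite /phi mem_arrangements; case: eqP => // rc.
  case/eqP: rm; rewrite /m /forest_leaves.
  have /(perm_map fst)/perm_sumn := perm_repr_perm (map fkey r).
  by rewrite rc -map_comp => <-; congr sumn; exact: eq_map.
have sphi : perm_invariant phi.
  move=> r r' rr'; rewrite /phi !mem_arrangements.
  by have /perm_reprP -> := perm_map fkey rr'.
have splitE : (fun t => (spine_code (size (c :: D)) t == Some (c :: D))%:R) =
    root_split phi h.
  apply/funext => -[[|t s]] //=; rewrite /phi mem_arrangements /h -natrM mulnb.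
  case: (spine_code _ t) => [D'|] /=; last by rewrite andbF.
  by congr (nat_of_bool _)%:R.
have E n : (1 < n)%N -> code_mean n (c :: D) = sibling_mean p n phi * code_mean (n - m) D.
  by move=> n1; rewrite /code_mean splitE (AG_mean_split p h n1 gphi).
apply: (@cvg_trans _ ((sibling_mean p n phi * code_mean (n - m) D) @[n --> \oo])).
  by apply: near_eq_cvg; near=> n; rewrite E//; near: n; exists 2%N.
apply: cvgM; last first.
  (* [n - m] tends to infinity with [n]. *)
  rewrite -(@cvg_shiftn m).
  by under eq_fun do rewrite addnK; exact: IH.
(* A cutoff for both the number of bushes and the number of leaves of each. *)
pose M := (m + size c)%N.
have <- : siblings_mean p b rho M phi = siblings_mass (arrangements c).
  apply: siblings_mean_keys; first exact: arrangements_uniq.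
  apply/allP => s; rewrite mem_arrangements => /eqP sc.
  have := perm_repr_perm s; rewrite sc => sp; rewrite (perm_size sp) lt0n size_eq0 c0 /=.
  rewrite leq_addl /=; apply/allP => x; rewrite (perm_mem sp) => xc.
  rewrite /M /m (leq_trans _ (leq_addr _ _))//.
  by rewrite (perm_sumn (perm_map fst (perm_to_rem xc))) /= leq_addr.
by apply: (cvg_sibling_mean b0 bS rho0 rhoS _ sphi gphi); exact: leq_addr.
Unshelve. all: by end_near. Qed.

End spine_code.

(** * Trees with the same code look alike near the root *)

(** The isomorphism permutes the children of each vertex of the infinite branch and is
    the identity inside the bushes. *)
Lemma spine_rtree_reindex (X : nat -> nat) (tau : nat -> nat -> rtree)
    (sigma : nat -> nat -> nat) :
  (forall n, set_bij `I_(X n).+1 `I_(X n).+1 (sigma n)) ->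
  tree_iso (spine_rtree X (fun n k => tau n (sigma n k))) (spine_rtree X tau).
Proof.
move=> sbij.
pose f := fix f n (u : seq nat) : seq nat := match u with
  | [::] => [::] | 0 :: w => 0%N :: f n.+1 w | k.+1 :: w => (sigma n k).+1 :: w end.
have fv n u : spine_vertex X (fun n k => tau n (sigma n k)) n u ->
    spine_vertex X tau n (f n u).
  elim: u n => [//|[|k] u IH] n /=; first exact: IH.
  move=> [kX tu]; split => //; have [sf _ _] := sbij n.
  by have /= := sf k; rewrite !ltnS; exact.
have finj n u v : spine_vertex X (fun n k => tau n (sigma n k)) n u ->
    spine_vertex X (fun n k => tau n (sigma n k)) n v -> f n u = f n v -> u = v.
  elim: u n v => [|[|k] u IH] n [|[|l] v] //=.
    by move=> su sv [] /IH ->.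
  move=> [kX _] [lX _] [kl ->]; have [_ si _] := sbij n.
  by rewrite (si k l)// inE /= ltnS.
have fsurj n v : spine_vertex X tau n v ->
    exists2 u, spine_vertex X (fun n k => tau n (sigma n k)) n u & f n u = v.
  elim: v n => [|[|k] v IH] n /=; first by exists [::].
    by move=> /IH[u su <-]; exists (0%N :: u).
  move=> [kX tv]; have [_ _ ss] := sbij n.
  have [|l /= lX lk] := ss k; first by rewrite /= ltnS.
  by exists (l.+1 :: v) => /=; rewrite lk.
have fpar n u : f n (parent u) = parent (f n u).
  elim: u n => [//|[|k] u IH] n; rewrite parent_cons /= parent_cons.
    rewrite -IH; case: u {IH} => [//|j u] /=.
    by case: j.
  by case: u {IH}.
exists (f 0%N); split => //; split.
- by move=> u; exact: fv.
- by move=> u v /[!inE]; exact: finj.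
- by move=> v /fsurj[u su <-]; exists u.
Qed.

Section spine_trees.
Context {R : realType}.

Lemma trunc_spine_tree_perm N (X X' : nat -> nat) (tau tau' : nat -> nat -> ltree R) :
  (forall n, (n <= N)%N -> perm_eq [seq tau n k | k <- iota 0 (X n).+1]
                                   [seq tau' n k | k <- iota 0 (X' n).+1]) ->
  trunc N (spine_tree X tau) = trunc N (spine_tree X' tau').
Proof.
move=> tautau'.
have XX' n : (n <= N)%N -> X n = X' n.
  by move=> /tautau'/perm_size; rewrite !size_map !size_iota => -[].
have /choice[sigma sigmaP] n : exists s, set_bij `I_(X n).+1 `I_(X n).+1 s /\
    ((n <= N)%N -> forall k, (k <= X n)%N -> tau' n k = tau n (s k)).
  have [nN|nN] := leqP n N; last first.
    by exists id; split => //; split => // k kX; exists k.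
  have := tautau' n nN; rewrite perm_sym => /(perm_iotaP (tau n 0%N)).
  rewrite size_map size_iota => -[Is IsX tauE].
  have sIs : size Is = (X n).+1 by rewrite (perm_size IsX) size_iota.
  have uIs : uniq Is by rewrite (perm_uniq IsX) iota_uniq.
  exists (nth 0%N Is); split; first split.
  - move=> k /= kX; have := mem_nth 0%N (_ : (k < size Is)%N).
    by rewrite sIs (perm_mem IsX) mem_iota; apply.
  - move=> k l /[!inE] /= kX lX /eqP; rewrite nth_uniq ?sIs// => /eqP.
    exact.
  - move=> l /= lX; have lIs : l \in Is by rewrite (perm_mem IsX) mem_iota.
    by exists (index l Is); rewrite /= ?nth_index// -sIs index_mem.
  - move=> _ k kX; have /(congr1 (fun s => nth (tau n 0%N) s k)) := tauE.
    rewrite (nth_map 0%N) ?size_iota -?XX' ?ltnS// nth_iota ?ltnS// add0n => ->.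
    rewrite (nth_map 0%N) ?sIs ?ltnS//.
    have := mem_nth 0%N (_ : (k < size Is)%N).
    rewrite sIs (perm_mem IsX) mem_iota ltnS => /(_ kX) sX.
    by rewrite (nth_map 0%N) ?size_iota// nth_iota.
rewrite /spine_tree !trunc_class; apply/tree_classP.
pose t n k := tree_repr (tau n k).
apply: (tree_iso_trans (s := rtree_trunc N (spine_rtree X (fun n k => t n (sigma n k))))).
  apply/tree_iso_sym/rtree_trunc_iso/spine_rtree_reindex => n.
  by have [] := sigmaP n.
apply: spine_rtree_trunc => // n k nN kX.
have [_ /(_ nN _ kX) ->] := sigmaP n.
exact: tree_iso_refl.
Qed.

Fixpoint spine_forest (n : nat) (t : ftree) : seq ftree :=
  if t is FNode (b :: s) then if n is n'.+1 then spine_forest n' b else s else [::].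

Variable p : AG_param R.

Lemma spine_codeP N t D : spine_code p N t = Some D ->
  D = [seq perm_repr (map (fkey p) (spine_forest n t)) | n <- iota 0 N].
Proof.
elim: N t D => [|N IH] [s] D /=; first by case.
case: s => [//|b s] /=; case bE: (spine_code p N b) => [D'|]//= -[<-].
congr cons; rewrite (IH _ _ bE) (iotaDl 1 0) -map_comp.
by apply: eq_map.
Qed.

(** The labelling of the children in [rtree_of] is the one of [spine_rtree]: the child
    [0] continues the spine and the child [k + 1] is the [k]-th sibling. That [D] has
    no empty entry means that every vertex of the spine has a sibling, as required by
    [spine_vertex], where [X n] is one less than the number of bushes. *)
Lemma spine_code_vertex N t D u : spine_code p N t = Some D -> [::] \notin D ->
  (size u <= N)%N ->
  fvertex t u <-> spine_vertex (fun n => (size (spine_forest n t)).-1)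
    (fun n k => rtree_of (nth fleaf (spine_forest n t) k)) 0 u.
Proof.
have shift X tau n w : spine_vertex X tau n.+1 w <->
    spine_vertex (fun n => X n.+1) (fun n => tau n.+1) n w.
  by elim: w n => [//|[|k] w IH] n /=; first exact: IH.
elim: u N t D => [//|i u IH] [//|N] [[//|b s]] D /=.
case bE: (spine_code p N b) => [D'|]//= [<-].
rewrite inE negb_or => /andP[s0 D'0]; rewrite ltnS => uN.
case: i => [|k].
  by apply: (iff_trans (IH _ _ _ bE D'0 uN)); apply: iff_sym; exact: shift.
have {}s0 : (0 < size s)%N.
  rewrite lt0n size_eq0; apply: contraNneq s0 => ->.
  by rewrite eq_sym -size_eq0 -(perm_size (perm_repr_perm _)).
rewrite -[onth (b :: s) k.+1]/(onth s k); case sk: (onth s k) => [c|].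
  have ks : (k < size s)%N by rewrite -onthTE sk.
  rewrite (@onth_nth _ fleaf c _ _ sk); split; last by case.
  move=> cu; split => //.
  by rewrite -ltnS prednK.
split => // -[+ _]; rewrite -ltnS prednK// => ks.
by move: ks; rewrite -onthTE sk.
Qed.

Lemma trunc_fclass N t D : spine_code p N t = Some D -> [::] \notin D ->
  trunc N (fclass t) = trunc N (spine_tree (fun n => (size (spine_forest n t)).-1)
    (fun n k => fclass (nth fleaf (spine_forest n t) k)) : ltree R).
Proof.
move=> tD D0; rewrite /spine_tree !trunc_class; apply/tree_classP.
pose X n := (size (spine_forest n t)).-1.
pose tau n k := rtree_of (nth fleaf (spine_forest n t) k).
apply: (tree_iso_trans (s := rtree_trunc N (spine_rtree X tau))).
  rewrite (_ : rtree_trunc N (rtree_of t) = rtree_trunc N (spine_rtree X tau)).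
    exact: tree_iso_refl.
  apply: rtree_eq; apply/seteqP; split => u /= [tu uN]; split => //.
    by apply/(spine_code_vertex tD D0 uN).
  by apply/(spine_code_vertex tD D0 uN).
apply: spine_rtree_trunc => // n k nN kX; apply: rtree_trunc_iso.
by apply/(@tree_classP R); rewrite tree_reprK.
Qed.

(** Keys determine trees on the support. It suffices that the trees of one of the lists
    are in the support: then no rank in the other list is that of a tree outside. *)
Lemma perm_key (l l' : seq (nat * ltree R)) :
  all (fun x => x.2 \in AG_support p x.1) l ->
  perm_eq (map (key p) l) (map (key p) l') -> perm_eq (map snd l) (map snd l').
Proof.
move=> /allP lP ll'.
pose decode (x : nat * nat) := nth (fclass fleaf) (AG_support p x.1) x.2.
have l'P x : x \in l' -> x.2 \in AG_support p x.1.
  move=> xl'; have : key p x \in map (key p) l by rewrite (perm_mem ll') map_f.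
  move=> /mapP[y /lP yl [xy]]; rewrite -!index_mem in yl *.
  by move=> ->; rewrite xy.
have keyK x : x.2 \in AG_support p x.1 -> decode (key p x) = x.2.
  by move=> xP; rewrite /decode /= nth_index.
have E s : (forall x, x \in s -> x.2 \in AG_support p x.1) ->
    map snd s = map decode (map (key p) s).
  by move=> sP; rewrite -map_comp; apply/eq_in_map => x /sP/keyK.
by rewrite (E l)// (E l')//; exact: perm_map.
Qed.

Definition spine_keys (X : nat -> nat) (Y : nat -> nat -> nat)
    (tau : nat -> nat -> ltree R) n :=
  [seq key p ((Y n k).+1, tau n k) | k <- iota 0 (X n).+1].

Lemma trunc_spine_tree_keys N X X' Y Y' tau tau' :
  (forall n k, (n <= N)%N -> (k <= X n)%N -> tau n k \in AG_support p (Y n k).+1) ->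
  (forall n, (n <= N)%N -> perm_eq (spine_keys X Y tau n) (spine_keys X' Y' tau' n)) ->
  trunc N (spine_tree X tau) = trunc N (spine_tree X' tau').
Proof.
move=> tauP keys; apply: trunc_spine_tree_perm => n nN.
pose l (Z : nat -> nat) (U : nat -> nat -> nat) (s : nat -> nat -> ltree R) :=
  [seq ((U n k).+1, s n k) | k <- iota 0 (Z n).+1].
have := @perm_key (l X Y tau) (l X' Y' tau'); rewrite -!map_comp; apply.
  by apply/allP => _ /mapP[k + ->]; rewrite mem_iota ltnS => kX; exact: tauP.
exact: keys.
Qed.

(** A code of length [N + 1] is read because the children of the vertex of height [N]
    are compared as well in [spine_rtree_trunc]. *)
Lemma trunc_fclass_keys N t X Y tau :
  (forall n k, (n <= N)%N -> (k <= X n)%N -> tau n k \in AG_support p (Y n k).+1) ->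
  spine_code p N.+1 t = Some [seq perm_repr (spine_keys X Y tau n) | n <- iota 0 N.+1] ->
  trunc N (fclass t) = trunc N (spine_tree X tau).
Proof.
move=> tauP tD; have := spine_codeP tD => /eq_in_map keysE.
have D0 : [::] \notin [seq perm_repr (spine_keys X Y tau n) | n <- iota 0 N.+1].
  apply/mapP => -[n _ /(congr1 size)].
  by rewrite -(perm_size (perm_repr_perm _)) size_map size_iota.
rewrite -(trunc_le (fclass t) (leqnSn N)) (trunc_fclass tD D0) trunc_le//.
apply/esym.
apply: (@trunc_spine_tree_keys _ _ _ Y
  (fun n k => (nleaves (nth fleaf (spine_forest n t) k)).-1)) => //.
move=> n nN; have := keysE n; rewrite mem_iota ltnS nN => /(_ isT)/perm_reprP.
move=> /perm_trans; apply; rewrite /spine_keys.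
have s0 : (0 < size (spine_forest n t))%N.
  have := keysE n; rewrite mem_iota ltnS nN => /(_ isT)/perm_reprP/perm_size.
  by rewrite !size_map size_iota => <-.
rewrite prednK// -{1}(mkseq_nth fleaf (spine_forest n t)) -map_comp.
rewrite (@eq_map _ _ _ (fun k => key p ((nleaves (nth fleaf (spine_forest n t) k)).-1.+1,
  fclass (nth fleaf (spine_forest n t) k)))) ?perm_refl// => k /=.
by rewrite prednK ?nleaves_gt0.
Qed.

End spine_trees.

(** * The law of the codes in the infinite tree *)

Section ltree_measurability.
Context {R : realType}.

Lemma ltree_measurable1 (c : ltree R) : measurable [set c].
Proof.
rewrite -[X in measurable X]setCK; apply: measurableC.
apply: sub_sigma_algebra; apply: closed_openC.
exact/accessible_closed_set1/hausdorff_accessible/metric_hausdorff.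
Qed.

Lemma measurable_index (s : seq (ltree R)) i : measurable [set c | index c s = i].
Proof.
elim: s i => [|a s IH] i.
  case: i => [|i]; first by rewrite (_ : [set _ | _] = setT)//; apply/seteqP.
  by rewrite (_ : [set _ | _] = set0)//; apply/seteqP; split.
rewrite (_ : [set c | index c (a :: s) = i] =
  if i is i'.+1 then ~` [set a] `&` [set c | index c s = i'] else [set a]).
  case: i => [|i]; first exact: ltree_measurable1.
  by apply: measurableI; [apply: measurableC; exact: ltree_measurable1|exact: IH].
apply/seteqP; split => c /=; case: i => [|i] /=.
- by case: eqP.
- by case: eqP => // ac [<-]; split => // ca; apply: ac.
- by move=> ->; rewrite eqxx.
- by move=> [ac <-]; case: eqP => // ca; case: ac.
Qed.

Lemma measurable_AG_support (p : AG_param R) n :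
  measurable [set c : ltree R | c \in AG_support p n].
Proof.
elim: (AG_support p n) => [|a s IH].
  by rewrite (_ : [set _ | _] = set0)//; apply/seteqP; split.
rewrite (_ : [set c | c \in a :: s] = [set a] `|` [set c | c \in s]).
  by apply: measurableU; [exact: ltree_measurable1|].
by apply/seteqP; split => c /=; rewrite inE; [move=> /predU1P|move=> h; apply/predU1P].
Qed.

Lemma AG_AG_mean (p : AG_param R) n (B : set (ltree R)) :
  AG p n B = (AG_mean p n (fun t => \1_B (fclass t)))%:E.
Proof.
rewrite /AG /= /AG_fun /AG_mean -sumEFin; apply: eq_bigr => q _.
by rewrite EFinM diracE.
Qed.

End ltree_measurability.

(** Continuity from below, used to retain finitely many codes. *)
Lemma ltr_bigcup_measure d (T : measurableType d) (R : realType)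
    (P : probability T R) (F : nat -> set T) (r : R) :
  (forall n, measurable (F n)) -> (forall n w, F n w -> F n.+1 w) ->
  (r%:E < P (\bigcup_n F n))%E -> exists n, (r%:E < P (F n))%E.
Proof.
move=> mF ndF rF; apply: contrapT => nF; move: rF; apply/negP; rewrite -leNgt.
have FP : P \o F @ \oo --> P (\bigcup_n F n).
  apply: nondecreasing_cvg_mu => //; first exact: bigcup_measurable.
  by apply/nondecreasing_seqP => n; apply/subsetPset => w; exact: ndF.
rewrite -(cvg_lim _ FP)//; apply: lime_le; first by apply/cvg_ex; exists (P (\bigcup_n F n)).
near=> n; rewrite leNgt; apply/negP => h; apply: nF; exists n.
exact: h.
Unshelve. all: by end_near. Qed.

Section local_topology.
Context {R : realType}.

Lemma continuous_ltree_measurable (f : ltree R -> R) :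
  continuous f -> measurable_fun setT f.
Proof.
move=> cf; apply: (measurability _ (RGenOpens.measurableE R)) => _ [_ [a [b ->]] <-].
rewrite setTI; apply: sub_sigma_algebra.
by apply: open_comp => [t _|]; [exact: cf|exact: interval_open].
Qed.

(** Balls of the local metric are the sets of trees with a given truncation. *)
Lemma continuous_trunc (f : ltree R -> R) (t : ltree R) (e : R) :
  continuous f -> 0 < e ->
  exists N, forall s, trunc N t = trunc N s -> `|f t - f s| < e.
Proof.
move=> cf e0; have [||N NP] := @open_trunc R (f @^-1` ball (f t) e) t.
- by apply: open_comp => [s _|]; [exact: cf|exact: ball_open].
- exact: ballxx.
- by exists N => s /NP.
Qed.

End local_topology.

Section AG_integral.
Context {R : realType} (p : AG_param R).

Lemma le_AG_mean n f g : (0 < n)%N -> (forall t, f t <= g t) ->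
  AG_mean p n f <= AG_mean p n g.
Proof.
move=> n0 fg; rewrite /AG_mean big_seq [leRHS]big_seq; apply: ler_sum => q qn.
by rewrite ler_wpM2l//; have [] := AG_dist_leaves n0 qn.
Qed.

Lemma ge0_integral_AG n (f : ltree R -> R) :
  measurable_fun setT f -> (forall t, 0 <= f t) ->
  (\int[AG p n]_t (f t)%:E = (AG_mean p n (f \o fclass))%:E)%E.
Proof.
move=> mf f0.
have mf' : measurable_fun setT (EFin \o f) by exact/measurable_EFinP.
rewrite (eq_measure_integral (msum (fun i => mscale (NngNum (AG_dist_ge0 p n i))
    \d_(tree_class (rtree_of (nth (0, fleaf) (AG_dist p n) i).2))) (size (AG_dist p n)))).
  rewrite ge0_integral_measure_sum//; last by move=> t _; rewrite lee_fin.
  rewrite /AG_mean (big_nth (0, fleaf)) big_mkord -sumEFin; apply: eq_bigr => i _.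
  rewrite ge0_integral_mscale//; last by move=> t _; rewrite lee_fin.
  by rewrite integral_dirac// diracT mul1e EFinM.
by move=> B mB _; exact: (congr1 (fun m => m B) (AG_funE p n)).
Qed.

End AG_integral.

Section spine_code_prefix.
Context {R : realType} (p : AG_param R).

Lemma spine_code_take M N t D : (M <= N)%N ->
  spine_code p N t = Some D -> spine_code p M t = Some (take M D).
Proof.
elim: M N t D => [|M IH] N t D; first by rewrite take0.
case: N t => [|N] [s] //=.
case: s => [//|b s]; rewrite ltnS => MN.
case bE: (spine_code p N b) => [D'|]//= [<-] /=.
by rewrite (IH _ _ _ MN bE).
Qed.

End spine_code_prefix.

Section family.
Context {R : realType} (p : AG_param R) (gamma_gt0 : 0 < ag_gamma p)
  (d : measure_display) (Omega : measurableType d) (P : probability Omega R)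
  (X : nat -> {RV P >-> nat}) (Y : nat -> nat -> {RV P >-> nat})
  (tau : nat -> nat -> {RV P >-> ltree R})
  (family : AG_infty_family p X Y tau).

Definition subtree_law (l : nat) : R := beta_geometric (ag_alpha p) l.
Definition degree_law (l : nat) : R := beta_geometric (ag_gamma p / ag_alpha p) l.

Lemma ag_alpha_gt0 : 0 < ag_alpha p.
Proof. exact: lt_le_trans gamma_gt0 (ag_gamma_le p). Qed.

Lemma ratio_le1 : ag_gamma p / ag_alpha p <= 1.
Proof. by rewrite ler_pdivrMr ?mul1r ?ag_gamma_le// ag_alpha_gt0. Qed.

Lemma subtree_law0 : subtree_law 0 = ag_alpha p.
Proof.
apply: beta_geometric0; exact: discrete_law_neq0 (AG_Y_law family 0 0).
Qed.

Lemma subtree_lawS l :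
  l.+2%:R * subtree_law l.+1 = (l.+1%:R - ag_alpha p) * subtree_law l.
Proof. by apply: beta_geometricS; exact: ag_alpha_le1. Qed.

Lemma degree_law0 : ag_alpha p * degree_law 0 = ag_gamma p.
Proof.
rewrite /degree_law beta_geometric0; last exact: discrete_law_neq0 (AG_X_law family 0).
by rewrite mulrC divfK// gt_eqF// ag_alpha_gt0.
Qed.

Lemma degree_lawS j : ag_alpha p * (j.+2%:R * degree_law j.+1) =
  (j.+1%:R * ag_alpha p - ag_gamma p) * degree_law j.
Proof.
rewrite beta_geometricS; last exact: ratio_le1.
rewrite mulrA; congr (_ * _); rewrite mulrBr mulrC; congr (_ - _).
by rewrite mulrC divfK// gt_eqF// ag_alpha_gt0.
Qed.

Local Notation keyrv n k w := (key p ((Y n k w).+1, tau n k w)).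
Local Notation mass := (key_mass p subtree_law).
Local Notation smass := (siblings_mass p subtree_law degree_law).

Let mX n l : measurable (X n @^-1` [set l]).
Proof. by rewrite -[Z in measurable Z]setTI; exact: measurable_funP. Qed.

Lemma key_eventE n k l i : [set w | keyrv n k w = (l.+1, i)] =
  Y n k @^-1` [set l] `&` tau n k @^-1` [set c | index c (AG_support p l.+1) = i].
Proof.
apply/seteqP; split => w /=; first by move=> [yl]; rewrite yl.
by move=> [<- <-].
Qed.

(** The event belongs to the sigma-algebra of the pair [(Y n k, tau n k)], as needed to
    apply independence. *)
Lemma key_event_law n k x :
  let E := [set w | keyrv n k w = x] in
  preimage_set_system setT (fun w => (Y n k w, tau n k w)) measurable E /\
  P E = (mass x)%:E.
Proof.
move=> E; rewrite /E; case: x @E => [[|l] i].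
  rewrite (_ : [set _ | _] = set0) ?measure0; last by apply/seteqP; split.
  by split => //; exists set0 => //; rewrite preimage_set0 setI0.
split.
  rewrite key_eventE; exists ([set l] `*` [set c | index c (AG_support p l.+1) = i]).
    by apply: measurableX => //; exact: measurable_index.
  by rewrite setTI; apply/seteqP; split.
rewrite key_eventE (AG_tau_law family)//; last exact: measurable_index.
rewrite (AG_Y_law family) AG_AG_mean -EFinM /key_mass /=; congr EFin.
congr (_ * _); congr AG_mean; apply/funext => t; rewrite indicE; congr (nat_of_bool _)%:R.
rewrite /key xpair_eqE eqxx /=.
by apply/idP/eqP; rewrite inE.
Qed.

Let mkey n k x : measurable [set w | keyrv n k w = x].
Proof.
have [[B mB <-] _] := key_event_law n k x; rewrite setTI.
by rewrite -[Z in measurable Z]setTI; apply: measurable_fun_pair.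
Qed.

Definition limit_keys n w := spine_keys p (X ^~ w) (fun n k => Y n k w) (fun n k => tau n k w) n.

Lemma keysP n w s : (0 < size s)%N -> limit_keys n w = s <->
  X n w = (size s).-1 /\ forall k, (k < size s)%N -> keyrv n k w = nth (0, 0)%N s k.
Proof.
move=> s0; split => [<-|[Xs ks]].
  rewrite size_map size_iota; split => // k kX.
  by rewrite (nth_map 0%N) ?size_iota// nth_iota.
apply: (@eq_from_nth _ (0, 0)%N); first by rewrite size_map size_iota Xs prednK.
move=> k; rewrite size_map size_iota => kX; rewrite (nth_map 0%N) ?size_iota//.
by rewrite nth_iota// add0n ks// -(prednK s0) -Xs.
Qed.

(** Independence, applied to the finitely many variables that determine the keys at the
    [N] first vertices: the [X n] and, once the number of bushes at each vertex is
    prescribed, the pairs [(Y n k, tau n k)]. *)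
Lemma keys_law N (s : nat -> seq (nat * nat)) :
  (forall n, (n < N)%N -> (0 < size (s n))%N) ->
  P [set w | forall n, (n < N)%N -> limit_keys n w = s n] =
  (\prod_(n < N) (degree_law (size (s n)).-1 * \prod_(x <- s n) mass x))%:E.
Proof.
move=> s0.
pose E (i : nat + nat * nat) := match i with
  | inl n => X n @^-1` [set (size (s n)).-1]
  | inr (n, k) => [set w | keyrv n k w = nth (0, 0)%N (s n) k] end.
pose l := [seq inl n | n <- iota 0 N] ++
  [seq (inr (n, k) : nat + nat * nat) | n <- iota 0 N, k <- iota 0 (size (s n))].
have ul : uniq l.
  rewrite cat_uniq map_inj_uniq ?iota_uniq//=; last by move=> ? ? [].
  apply/andP; split.
    by apply/hasPn => _ /allpairsPdep[n [k [_ _ ->]]]; apply/mapP => -[].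
  apply: allpairs_uniq_dep => //; first exact: iota_uniq.
    by move=> n _; exact: iota_uniq.
  by move=> [n k] [n' k'] _ _ /= [-> ->].
pose J : {fset (nat + nat * nat)%type} := [fset i in l]%fset.
have JE : perm_eq J l.
  apply: uniq_perm => [||i]; [exact: fset_uniq|exact: ul|].
  rewrite -[i \in enum_fset J]/(i \in J) /J.
  by case: l {ul J} => [|? ?]; rewrite !inE.
have -> : [set w | forall n, (n < N)%N -> limit_keys n w = s n] =
    \bigcap_(i in [set` J]) E i.
  apply/seteqP; split => w /=.
    move=> h i /=; rewrite (perm_mem JE) mem_cat => /orP[/mapP[n + ->]|].
      by rewrite mem_iota => nN; have /keysP[|] := h n nN; first exact: s0.
    move=> /allpairsPdep[n [k [+ + ->]]]; rewrite !mem_iota => nN ks /=.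
    by have /keysP[|_] := h n nN; [exact: s0|exact].
  move=> h n nN; apply/keysP; first exact: s0.
  split; first by apply: (h (inl n)); rewrite /= (perm_mem JE) mem_cat map_f// mem_iota.
  move=> k ks; apply: (h (inr (n, k))); rewrite /= (perm_mem JE) mem_cat.
  apply/orP; right; apply/allpairsPdep; exists n, k; split => //; rewrite mem_iota//.
rewrite (AG_independent family); last first.
  move=> [n|[n k]] _ /=; last by have [] := key_event_law n k (nth (0, 0)%N (s n) k).
  by exists [set (size (s n)).-1] => //; rewrite setTI.
rewrite (perm_big _ JE) /= big_cat big_map big_allpairs_dep /=.
rewrite -(big_mkord xpredT (fun n => degree_law (size (s n)).-1 * \prod_(x <- s n) mass x)).
rewrite big_split /= EFinM; congr (_ * _)%E.
  rewrite -prodEFin /index_iota subn0; apply: eq_bigr => n _.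
  exact: (AG_X_law family).
rewrite -prodEFin /index_iota subn0; apply: eq_bigr => n _.
rewrite -prodEFin (big_nth (0, 0)%N) /index_iota subn0; apply: eq_bigr => k _.
by have [_ ->] := key_event_law n k (nth (0, 0)%N (s n) k).
Qed.

Let mkeys n s : measurable [set w | limit_keys n w = s].
Proof.
case: s => [|x s].
  by rewrite (_ : [set _ | _] = set0)//; apply/seteqP; split.
rewrite (_ : [set _ | _] = X n @^-1` [set size s] `&`
   \bigcap_(k in `I_(size s).+1) [set w | keyrv n k w = nth (0, 0)%N (x :: s) k]).
  apply: measurableI => //; apply: fin_bigcap_measurable => // k _; exact: mkey.
apply/seteqP; split => w /=.
  by move=> /keysP[//|Xs h]; split => // k /= /h.
by move=> [Xs h]; apply/keysP => //; split => // k /h.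
Qed.

Let mkeys_in n (S : seq (seq (nat * nat))) : measurable [set w | limit_keys n w \in S].
Proof.
elim: S => [|s S IH].
  by rewrite (_ : [set _ | _] = set0)//; apply/seteqP; split.
rewrite (_ : [set _ | _] = [set w | limit_keys n w = s] `|` [set w | limit_keys n w \in S]).
  by apply: measurableU.
by apply/seteqP; split => w /=; rewrite inE; [move=> /predU1P|move=> h; apply/predU1P].
Qed.

Lemma measurable_keys_in N (S : nat -> seq (seq (nat * nat))) :
  measurable [set w | forall n, (n < N)%N -> limit_keys n w \in S n].
Proof.
rewrite (_ : [set _ | _] = \bigcap_(n in `I_N) [set w | limit_keys n w \in S n]).
  by apply: fin_bigcap_measurable => // n _; exact: mkeys_in.
by apply/seteqP; split => w /= h n; exact: h.
Qed.

(** Expansion of a product of sums: when all [S n] are singletons this is [keys_law], and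
    both sides are additive in each [S n]. The induction on [r] treats the case where
    [S n] is a singleton for [n >= r]. *)
Lemma keys_in_law N (S : nat -> seq (seq (nat * nat))) :
  (forall n, (n < N)%N -> uniq (S n)) ->
  (forall n, (n < N)%N -> [::] \notin S n) ->
  P [set w | forall n, (n < N)%N -> limit_keys n w \in S n] =
  (\prod_(n < N) smass (S n))%:E.
Proof.
move=> uS S0.
suff H r : (r <= N)%N -> forall S : nat -> seq (seq (nat * nat)),
    (forall n, (n < N)%N -> uniq (S n)) ->
    (forall n, (n < N)%N -> [::] \notin S n) ->
    (forall n, (r <= n < N)%N -> size (S n) = 1%N) ->
    P [set w | forall n, (n < N)%N -> limit_keys n w \in S n] =
    (\prod_(n < N) smass (S n))%:E.
  by apply: (H N) => // n; case: ltnP; rewrite ?andbF.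
elim: r => [|r IH] rN {uS S0} {}S uS S0 S1.
  pose s n := head [::] (S n).
  have sE n : (n < N)%N -> S n = [:: s n].
    by move=> nN; have := S1 n nN; rewrite /s; case: (S n) => [|? []].
  rewrite (_ : [set _ | _] = [set w | forall n, (n < N)%N -> limit_keys n w = s n]).
    rewrite keys_law; last first.
      by move=> n nN; have := S0 n nN; rewrite sE// inE eq_sym lt0n size_eq0.
    congr EFin; apply: eq_bigr => n _.
    by rewrite sE// /siblings_mass big_seq1.
  apply/seteqP; split => w /= h n nN; have := h n nN.
    by rewrite sE// inE => /eqP.
  by rewrite sE// inE => ->.
(* [S] with its entry of index [r] replaced by [L]. *)
pose upd L n := if n == r then L else S n.
have SE : S = upd (S r) by apply/funext => n; rewrite /upd; case: eqP => // ->.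
suff : uniq (S r) -> [::] \notin S r ->
    P [set w | forall n, (n < N)%N -> limit_keys n w \in upd (S r) n] =
    (\prod_(n < N) smass (upd (S r) n))%:E.
  by rewrite -SE; apply; [exact: uS|exact: S0].
have updmass L : \prod_(n < N) smass (upd L n) =
    smass L * \prod_(n < N | n != Ordinal rN) smass (S n).
  rewrite (bigD1 (Ordinal rN))//= {1}/upd eqxx; congr (_ * _).
  by apply: eq_bigr => n nr; rewrite /upd ifN.
elim: (S r) => [|s L IHL] /=.
  move=> _ _; rewrite updmass /siblings_mass big_nil mul0r.
  rewrite (_ : [set _ | _] = set0) ?measure0//; apply/seteqP; split => // w /=.
  by move=> /(_ r rN); rewrite /upd eqxx.
rewrite inE negb_or => /andP[sL uL] /andP[s0 L0].
rewrite (_ : [set _ | _] =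
  [set w | forall n, (n < N)%N -> limit_keys n w \in upd [:: s] n] `|`
  [set w | forall n, (n < N)%N -> limit_keys n w \in upd L n]); last first.
  apply/seteqP; split => w /=.
    move=> h; have := h r rN; rewrite {1}/upd eqxx inE => /orP[ws|wL]; [left|right].
      move=> n nN; have := h n nN; rewrite /upd.
      by have [->|//] := eqVneq n r; rewrite !inE ws.
    move=> n nN; have := h n nN; rewrite /upd.
    by have [->|//] := eqVneq n r.
  by move=> [] h n nN; have := h n nN; rewrite /upd;
     have [->|//] := eqVneq n r; rewrite !inE => ->//; rewrite orbT.
set E1 := [set w | forall n, _ -> limit_keys n w \in upd [:: s] n].
set E2 := [set w | forall n, _ -> limit_keys n w \in upd L n].
have -> : P (E1 `|` E2) = (P E1 + P E2)%E.
  apply: measureU; [exact: measurable_keys_in|exact: measurable_keys_in|].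
  apply/seteqP; split => // w [] /= /(_ r rN) + /(_ r rN).
  by rewrite /upd eqxx inE => /eqP ->; rewrite (negbTE sL).
rewrite (IHL uL L0) (IH (ltnW rN)); first last.
- move=> n /andP[rn nN]; rewrite /upd; case: eqP => // /eqP nr.
  by apply: S1; rewrite nN ltn_neqAle rn eq_sym nr.
- by move=> n nN; rewrite /upd; case: eqP => // _; [rewrite inE|exact: S0].
- by move=> n nN; rewrite /upd; case: eqP => // _; exact: uS.
rewrite -EFinD !updmass -mulrDl; congr (_ * _)%:E.
by rewrite /siblings_mass big_seq1 big_cons.
Qed.

Definition limit_code M w := [seq perm_repr (limit_keys n w) | n <- iota 0 M].

Lemma size_code M w : size (limit_code M w) = M.
Proof. by rewrite size_map size_iota. Qed.

Lemma code_nil M w : [::] \notin limit_code M w.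
Proof.
apply/mapP => -[n _ /(congr1 size)].
by rewrite -(perm_size (perm_repr_perm _)) size_map size_iota.
Qed.

Lemma take_code M N w : (M <= N)%N -> take M (limit_code N w) = limit_code M w.
Proof. by move=> MN; rewrite /limit_code -map_take take_iota (minn_idPl MN). Qed.

Let codeE M D : size D = M -> [set w | limit_code M w = D] =
  [set w | forall n, (n < M)%N -> limit_keys n w \in arrangements (nth [::] D n)].
Proof.
move=> DM; apply/seteqP; split => w /=.
  move=> <- n nM; rewrite mem_arrangements (nth_map 0%N) ?size_iota// nth_iota//.
move=> h; apply: (@eq_from_nth _ [::]); rewrite size_code// => n nM.
rewrite (nth_map 0%N) ?size_iota// nth_iota// add0n.
by apply/eqP; rewrite -mem_arrangements; exact: h.
Qed.

Lemma measurable_code M (Q : seq (seq (nat * nat)) -> Prop) :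
  measurable [set w | Q (limit_code M w)].
Proof.
rewrite (_ : [set _ | _] = \bigcup_(D in Q) [set w | limit_code M w = D]); last first.
  by apply/seteqP; split => w /=; [move=> Qw; exists (limit_code M w)|move=> [D QD /= ->]].
rewrite bigcup_mkcond; apply: countable_bigcupT_measurable => [|D]; first exact: countableP.
case: ifP => // _; have [DM|DM] := eqVneq (size D) M.
  rewrite (codeE DM); exact: measurable_keys_in.
rewrite (_ : [set _ | _] = set0)//; apply/seteqP; split => // w /= wD.
by move: DM; rewrite -wD size_code eqxx.
Qed.

Lemma code_law M D : size D = M -> [::] \notin D ->
  P [set w | limit_code M w = D] = (\prod_(c <- D) smass (arrangements c))%:E.
Proof.
move=> DM D0; rewrite (codeE DM) keys_in_law.
- by rewrite (big_nth [::]) big_mkord DM.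
- by move=> n _; exact: arrangements_uniq.
- move=> n nM; rewrite mem_arrangements; apply/eqP => nD.
  have /negP := D0; apply; have := mem_nth [::] (_ : (n < size D)%N).
  rewrite -nD DM => /(_ nM).
  suff -> : perm_repr ([::] : seq (nat * nat)) = [::] by [].
  by apply/eqP; rewrite -size_eq0 -(perm_size (perm_repr_perm _)).
Qed.

(** * From codes to weak convergence *)

(** Given [Y n k = l], the tree [tau n k] has law AG^(l+1), which is carried by finitely
    many trees. *)
Lemma supported_ae : P.-negligible
  (~` [set w | forall n k, tau n k w \in AG_support p (Y n k w).+1]).
Proof.
rewrite (_ : ~` _ = \bigcup_n \bigcup_k \bigcup_l (Y n k @^-1` [set l] `&`
    tau n k @^-1` (~` [set c | c \in AG_support p l.+1]))); last first.
  apply/seteqP; split => w /=.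
    by move=> /existsNP[n /existsNP[k h]]; exists n => //; exists k => //; exists (Y n k w).
  by move=> [n _ [k _ [l _ [/= <- h]]]] /(_ n k).
apply: negligible_bigcup => n; apply: negligible_bigcup => k.
apply: negligible_bigcup => l.
have mS : measurable (~` [set c : ltree R | c \in AG_support p l.+1]).
  by apply: measurableC; exact: measurable_AG_support.
exists (Y n k @^-1` [set l] `&` tau n k @^-1` (~` [set c | c \in AG_support p l.+1])).
split => //.
  by apply: measurableI; rewrite -[Z in measurable Z]setTI; exact: measurable_funP.
apply: etrans (AG_tau_law family n k l mS) _.
rewrite AG_AG_mean (_ : AG_mean _ _ _ = 0) ?mule0//.
rewrite /AG_mean big_seq big1// => q qn; rewrite indicE memNset ?mulr0//=.
by apply; apply/mapP; exists q.
Qed.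

Let T w : ltree R := spine_rv X tau w.

(** On the event described by a good code, [g] is within [e] of [v]. Only the bound from
    below is recorded for the finite trees, and only the one from above for the infinite
    tree, as the aim is an inequality between integrals. *)
Definition good_code (g : ltree R -> R) (e : R) (N : nat) (D : seq (seq (nat * nat))) v :=
  [/\ 0 <= v, (forall t, spine_code p N t = Some D -> v <= g (fclass t) + e) &
      (forall w, limit_code N w = D -> g (T w) <= v + e)].

(** At each tree, [g] varies by less than [e] on a ball of some radius [N], and the code of
    length [N + 1] determines this ball. *)
Lemma good_code_ae (g : ltree R -> R) (e : R) : continuous g -> (forall t, 0 <= g t) -> 0 < e ->
  P (\bigcup_N [set w | exists v, good_code g e N (limit_code N w) v]) = 1%E.
Proof.
move=> cg g0 e0.
set U := \bigcup_N _.
have mU : measurable U.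
  apply: bigcup_measurable => N _.
  exact: (measurable_code N (fun D => exists v, good_code g e N D v)).
have : P.-negligible (~` U).
  apply: negligibleS supported_ae => w /= nU wS; apply: nU.
  have [N NP] := continuous_trunc (T w) cg e0.
  exists N.+1 => //; exists (g (T w)); split => // [t tD|w' ww'].
    have : trunc N (fclass t) = trunc N (T w).
      by apply: trunc_fclass_keys tD => n k _ _; exact: wS.
    by move=> /esym/NP; rewrite ltr_distlC => /andP[]; lra.
  have : trunc N (T w) = trunc N (T w').
    apply: (@trunc_spine_tree_keys _ p N _ _ (fun n k => Y n k w) (fun n k => Y n k w')).
      by move=> n k _ _; exact: wS.
    move=> n nN; apply/perm_reprP.
    by move/esym: ww' => /eq_in_map; apply; rewrite mem_iota.
  by move=> /NP; rewrite ltr_distlC => /andP[]; lra.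
move=> /(negligibleP P (measurableC mU)) PU.
have := probability_setC P mU; rewrite PU => /esym/eqP.
by rewrite sube_eq ?add0e => // /eqP.
Qed.

Lemma cvg_code M D : size D = M -> [::] \notin D ->
  (code_mean p n D)%:E @[n --> \oo] --> P [set w | limit_code M w = D].
Proof.
move=> DM D0; rewrite code_law//; apply: cvg_EFin; first by near=> n.
apply: (cvg_code_mean (b := subtree_law) (rho := degree_law)) => //.
- exact: subtree_law0.
- exact: subtree_lawS.
- exact: degree_law0.
- exact: degree_lawS.
Unshelve. all: by end_near. Qed.

Lemma good_codeS (g : ltree R -> R) (e : R) N w v :
  good_code g e N (limit_code N w) v -> good_code g e N.+1 (limit_code N.+1 w) v.
Proof.
move=> [v0 gt gw]; split => // [t tD|w' ww'].
  apply: gt; rewrite (spine_code_take (leqnSn N) tD).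
  by rewrite take_code.
apply: gw; rewrite -(@take_code N N.+1 w')// ww'.
by rewrite take_code.
Qed.

(** Continuity from below is used twice: first for the length [N], since a longer code of
    a tree with a good code is good ([good_codeS]), and then for the number of codes of
    that length, which are enumerated by [choice.pickle]. *)
Lemma exists_good_codes (g : ltree R -> R) (e : R) :
  continuous g -> (forall t, 0 <= g t) -> 0 < e ->
  exists N (Ds : seq (seq (seq (nat * nat)))) (v : seq (seq (nat * nat)) -> R),
    [/\ uniq Ds, forall D, 0 <= v D,
       {in Ds, forall D, [/\ size D = N, [::] \notin D & good_code g e N D (v D)]} &
       ((1 - e)%:E < P [set w | limit_code N w \in Ds])%E].
Proof.
move=> cg g0 e0.
pose good N D := exists v : R, good_code g e N D v.
have lt1 : ((1 - e)%:E < P (\bigcup_N [set w | good N (limit_code N w)]))%E.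
  by rewrite good_code_ae// lte_fin; lra.
have [||N] := ltr_bigcup_measure _ _ lt1.
- by move=> N; exact: measurable_code.
- by move=> N w [v /good_codeS]; exists v.
have -> : [set w | good N (limit_code N w)] =
    \bigcup_K [set w | good N (limit_code N w) /\ (choice.pickle (limit_code N w) < K)%N].
  apply/seteqP; split => w /=; last by move=> [K _ []].
  by move=> wN; exists (choice.pickle (limit_code N w)).+1.
move=> {}lt1; have [||K {}lt1] := ltr_bigcup_measure _ _ lt1.
- move=> K; exact: (measurable_code N (fun D => good N D /\ (choice.pickle D < K)%N)).
- by move=> K w [? h]; split => //; exact: ltnW.
have /choice[v vP] D : exists v, 0 <= v /\ (good N D -> good_code g e N D v).
  have [[v Dv]|nD] := pselect (good N D); last by exists 0.
  by exists v; split => //; have [] := Dv.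
pose Ds := undup [seq D <- pmap choice.unpickle (iota 0 K) |
  `[< good N D >] && ((size D == N) && ([::] \notin D))].
exists N, Ds, v; split.
- exact: undup_uniq.
- by move=> D; have [] := vP D.
- move=> D; rewrite mem_undup mem_filter => /andP[/and3P[/asboolP gD /eqP DN D0] _].
  by split => //; have [_] := vP D; exact.
- apply: (lt_le_trans lt1); apply: le_measure; rewrite ?inE.
  + exact: (measurable_code N (fun D => good N D /\ (choice.pickle D < K)%N)).
  + exact: (measurable_code N (fun D => D \in Ds)).
  + move=> w /= [gw wK]; rewrite mem_undup mem_filter size_code eqxx code_nil.
    rewrite andbT andbT; apply/andP; split; first exact/asboolP.
    rewrite mem_pmap; apply/mapP; exists (choice.pickle (limit_code N w)).
      by rewrite mem_iota.
    by rewrite choice.pickleK.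
Qed.

(** Up to [e1], the integral under the limiting law is at most the sum of the values
    [v D] weighted by the probabilities of the codes, plus [C] times the small
    probability of the other codes. The integral under AG^n is at least the same sum
    with the probabilities of the codes in T_n, which converge. *)
Lemma liminf_AG (g : ltree R -> R) (C e : R) : continuous g ->
  (forall t, 0 <= g t <= C) -> 0 < e ->
  \forall n \near \oo, (\int[distribution P (spine_rv X tau)]_t (g t)%:E <=
    \int[AG p n]_t (g t)%:E + e%:E)%E.
Proof.
move=> cg gC e0.
have g0 t : 0 <= g t by have /andP[] := gC t.
have C0 : 0 <= C by have /andP[h1 h2] := gC (fclass fleaf); exact: le_trans h2.
have mg : measurable_fun setT g by exact: continuous_ltree_measurable.
have mTg : measurable_fun setT (g \o T) by apply: measurableT_comp.
have C4 : 0 < C + 3 by lra.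
(* The error is [e1] in each of three comparisons and [C * e1] on the remaining codes. *)
pose e1 := e / (C + 3).
have e10 : 0 < e1 by exact: divr_gt0.
have [N [Ds [v [uDs v0 DsP PDs]]]] := exists_good_codes cg g0 e10.
pose A D := [set w | limit_code N w = D].
pose W := [set w | limit_code N w \in Ds].
have mA D : measurable (A D) by exact: (measurable_code N (fun D' => D' = D)).
have mW : measurable W by exact: (measurable_code N (fun D' => D' \in Ds)).
pose q D := fine (P (A D)).
have qE D : (q D)%:E = P (A D) by rewrite /q fineK// fin_num_measure.
have upper : (\int[distribution P (spine_rv X tau)]_t (g t)%:E <=
    (e1 + \sum_(D <- Ds) v D * q D + C * e1)%:E)%E.
  rewrite ge0_integral_distribution//; last exact/measurable_EFinP.
  have mETg : measurable_fun setT (EFin \o (g \o T)) by exact/measurable_EFinP.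
  have mind (B : set Omega) : measurable B -> measurable_fun setT (fun w => (\1_B w)%:E : \bar R).
    move=> mB; have : measurable_fun setT (EFin \o (\1_B : Omega -> R)) => //.
    by apply/measurable_EFinP; exact: measurable_indic.
  have mZind (c : R) (B : set Omega) : measurable B ->
      measurable_fun setT (fun w => c%:E * (\1_B w)%:E)%E.
    by move=> mB; apply: measurable_funeM; exact: mind.
  have ind0 (c : R) (B : set Omega) w : 0 <= c -> (0 <= c%:E * (\1_B w)%:E)%E.
    by move=> c0; rewrite -EFinM lee_fin mulr_ge0// indicE.
  have Iind (c : R) (B : set Omega) : 0 <= c -> measurable B ->
      (\int[P]_w (c%:E * (\1_B w)%:E) = c%:E * P B)%E.
    move=> c0 mB; rewrite ge0_integralZl_EFin//; last exact: mind.
    by rewrite integral_indic// setIT.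
  have msum : measurable_fun setT (fun w => \sum_(D <- Ds) (v D)%:E * (\1_(A D) w)%:E)%E.
    by apply: emeasurable_sum => D; exact: mZind.
  have sum0 w : (0 <= \sum_(D <- Ds) (v D)%:E * (\1_(A D) w)%:E)%E.
    by apply: sume_ge0 => D _; exact: ind0.
  apply: (@le_trans _ _ (\int[P]_w (e1%:E + (\sum_(D <- Ds) (v D)%:E * (\1_(A D) w)%:E +
     C%:E * (\1_(~` W) w)%:E)))%E).
    apply: ge0_le_integral => //.
    - by move=> w _; rewrite lee_fin.
    - apply: emeasurable_funD => //; apply: emeasurable_funD => //.
      by apply: mZind; exact: measurableC.
    - move=> w _ /=; rewrite -EFinM.
      have -> : (\sum_(D <- Ds) (v D)%:E * (\1_(A D) w)%:E =
         (\sum_(D <- Ds) v D * \1_(A D) w)%:E)%E.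
        by rewrite -sumEFin; apply: eq_bigr => D _; rewrite EFinM.
      rewrite -!EFinD lee_fin.
      have s0 : 0 <= \sum_(D <- Ds) v D * \1_(A D) w.
        by apply: sumr_ge0 => D _; rewrite mulr_ge0// indicE.
      have [wW|wW] := boolP (limit_code N w \in Ds); last first.
        rewrite [\1_(~` W) w]indicE mem_set ?mulr1; last exact/negP.
        by have /andP[_] := gC (T w); rewrite /T; lra.
      rewrite [\1_(~` W) w]indicE memNset ?mulr0 ?addr0; last by move=> /(_ wW).
      rewrite (bigD1_seq (limit_code N w))//= indicE mem_set// mulr1.
      have [_ _ [_ _ /(_ w erefl)]] := DsP _ wW.
      suff : 0 <= \sum_(D <- Ds | D != limit_code N w) v D * \1_(A D) w by rewrite /T /=; lra.
      by apply: sumr_ge0 => D _; rewrite mulr_ge0// indicE.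
  rewrite ge0_integralD//; last 3 first.
  - by move=> w _; rewrite lee_fin ltW.
  - by move=> w _; rewrite adde_ge0// ind0.
  - by apply: emeasurable_funD => //; apply: mZind; exact: measurableC.
  rewrite integral_cst// [X in (e1%:E * X + _)%E](probability_setT P) mule1.
  rewrite ge0_integralD//; [|by move=> w _; exact: ind0|]; last first.
    by apply: mZind; exact: measurableC.
  rewrite ge0_integral_sum//; [|by move=> D; exact: mZind|by move=> D w _; exact: ind0].
  rewrite Iind//; last exact: measurableC.
  rewrite (eq_bigr (fun D => (v D * q D)%:E)); last first.
    by move=> D _; rewrite Iind// -qE EFinM.
  rewrite sumEFin -addrA !EFinD; apply: leeD => //; apply: leeD => //.
  rewrite EFinM; apply: lee_wpmul2l; first by rewrite lee_fin.
  rewrite probability_setC// leeBlDr ?fin_num_measure//.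
  have : (P W)%E \is a fin_num by rewrite fin_num_measure.
  move: PDs; rewrite -/W; case: (P W) => // r; rewrite lte_fin => h _.
  by rewrite -EFinD lee_fin; lra.
have lower n : (0 < n)%N ->
    \sum_(D <- Ds) v D * code_mean p n D <= AG_mean p n (g \o fclass) + e1.
  move=> n0; rewrite -[X in _ + X]mulr1 -(AG_mean1 p n) -AG_meanZ -AG_meanD.
  rewrite (_ : \sum_(D <- Ds) _ = AG_mean p n (fun t =>
    \sum_(D <- Ds) v D * (spine_code p (size D) t == Some D)%:R)); last first.
    rewrite /AG_mean; under [RHS]eq_bigr do rewrite mulr_sumr.
    rewrite exchange_big; apply: eq_bigr => D _; rewrite -AG_meanZ.
    by apply: eq_bigr => x _.
  apply: le_AG_mean => // t; rewrite mulr1 /=.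
  case tD: (spine_code p N t) => [D0|]; last first.
    rewrite big_seq big1 ?addr_ge0 ?(ltW e10)// => D DDs.
    by have [-> _ _] := DsP _ DDs; rewrite tD mulr0.
  have [D0Ds|D0Ds] := boolP (D0 \in Ds); last first.
    rewrite big_seq big1 ?addr_ge0 ?(ltW e10)// => D DDs.
    have [-> _ _] := DsP _ DDs; rewrite tD.
    by case: eqP => [[D0D]|]; rewrite ?mulr0//; move: D0Ds; rewrite D0D DDs.
  rewrite (bigD1_seq D0)//= [X in _ + X]big_seq_cond [X in _ + X]big1; last first.
    move=> D /andP[DDs DD0]; have [-> _ _] := DsP _ DDs; rewrite tD.
    by case: eqP => [[D0D]|]; rewrite ?mulr0//; move: DD0; rewrite D0D eqxx.
  have [-> _ [_ h _]] := DsP _ D0Ds.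
  by rewrite tD eqxx mulr1 addr0; exact: h.
have lim : \sum_(D <- Ds) v D * code_mean p n D @[n --> \oo] --> \sum_(D <- Ds) v D * q D.
  have limD D : D \in Ds -> v D * code_mean p n D @[n --> \oo] --> v D * q D.
    move=> DDs; have [DN D0 _] := DsP _ DDs; apply: cvgMl_tmp.
    by have := cvg_code DN D0; rewrite -qE => /fine_cvgP[].
  elim: (Ds) limD => [_|D Ds' IH] limD.
    rewrite big_nil; under eq_fun do rewrite big_nil.
    exact: cvg_cst.
  rewrite big_cons; under eq_fun do rewrite big_cons.
  apply: cvgD.
    by apply: limD; rewrite inE eqxx.
  by apply: IH => D' D'Ds; apply: limD; rewrite inE D'Ds orbT.
have : \forall n \near \oo, \sum_(D <- Ds) v D * q D <= \sum_(D <- Ds) v D * code_mean p n D + e1.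
  move/cvgrPdist_le : lim => /(_ _ e10); apply: filterS => n.
  by rewrite ler_distlC => /andP[]; lra.
move=> near1; near=> n.
have n0 : (0 < n)%N by near: n; exists 1%N.
rewrite ge0_integral_AG// -EFinD; apply: (le_trans upper); rewrite lee_fin.
have := lower n n0.
have : \sum_(D <- Ds) v D * q D <= \sum_(D <- Ds) v D * code_mean p n D + e1 by near: n.
have : e = e1 * (C + 3) by rewrite /e1 divfK// gt_eqF.
by move=> ->; lra.
Unshelve. all: by end_near. Qed.

End family.

Section weak_convergence.
Context {R : realType} d (T : measurableType d) (mu : probability T R)
  (f : T -> R) (C : R).
Hypotheses (mf : measurable_fun setT f) (fC : forall t, `|f t| <= C).

Let intf : mu.-integrable setT (EFin \o f).
Proof.
apply: measurable_bounded_integrable => //.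
  by rewrite [X in (X < _)%E](probability_setT mu) ltry.
by exists C; split => [|M /ltW CM t _]; [exact: num_real|exact: le_trans (fC t) CM].
Qed.

Let int_cst : (\int[mu]_t cst C%:E t = C%:E)%E.
Proof. by rewrite integral_cst// [X in (_ * X)%E](probability_setT mu) mule1. Qed.

Lemma integral_bounded_fin_num : (\int[mu]_t (f t)%:E \is a fin_num)%E.
Proof. exact: integrable_fin_num. Qed.

Lemma integral_addC : (\int[mu]_t (f t + C)%:E = \int[mu]_t (f t)%:E + C%:E)%E.
Proof.
have intC : mu.-integrable setT (EFin \o cst C) by exact: finite_measure_integrable_cst.
under eq_integral do rewrite EFinD.
rewrite integralD_EFin//; congr (_ + _)%E.
exact: int_cst.
Qed.

Lemma integral_Csub : (\int[mu]_t (C - f t)%:E = C%:E - \int[mu]_t (f t)%:E)%E.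
Proof.
have intC : mu.-integrable setT (EFin \o cst C) by exact: finite_measure_integrable_cst.
under eq_integral do rewrite EFinB.
rewrite (integralB_EFin _ intC)//; congr (_ - _)%E.
exact: int_cst.
Qed.

End weak_convergence.

Theorem proposition5p12 (R : realType) (p : AG_param R)
    (gamma_gt0 : 0 < ag_gamma p)
    (d : measure_display) (Omega : measurableType d) (P : probability Omega R)
    (X : nat -> {RV P >-> nat}) (Y : nat -> nat -> {RV P >-> nat})
    (tau : nat -> nat -> {RV P >-> ltree R})
    (family : AG_infty_family p X Y tau) :
  weakly_converges (AG p) (distribution P (spine_rv X tau)).
Proof.
move=> f cf [M [_ fM]]; pose C := M + 1.
have fC t : `|f t| <= C by apply: fM => //; rewrite ltrDl.
have mf := continuous_ltree_measurable cf.
have fCb t : 0 <= f t + C <= C + C /\ 0 <= C - f t <= C + C.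
  by have := fC t; rewrite ler_norml => /andP[]; lra.
have cD : continuous (fun t => f t + C) by move=> t; apply: (cvgD (cf t)); exact: cvg_cst.
have cB : continuous (fun t => C - f t) by move=> t; apply: (cvgB _ (cf t)); exact: cvg_cst.
set nu := distribution P _.
have IE (mu : probability (ltree R) R) := fineK (integral_bounded_fin_num mu mf fC).
rewrite -(IE nu) (_ : (fun n => _) = (fun n => (fine (\int[AG p n]_t (f t)%:E))%:E)%E); last first.
  by apply/funext => n; rewrite (IE (AG p n)).
apply: cvg_EFin; first by near=> n.
apply/cvgrPdist_le => e e0; near=> n.
have lo : (\int[nu]_t (f t + C)%:E <= \int[AG p n]_t (f t + C)%:E + e%:E)%E.
  near: n; apply: (liminf_AG gamma_gt0 family cD _ e0 (C := C + C)) => t.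
  by have [] := fCb t.
have hi : (\int[nu]_t (C - f t)%:E <= \int[AG p n]_t (C - f t)%:E + e%:E)%E.
  near: n; apply: (liminf_AG gamma_gt0 family cB _ e0 (C := C + C)) => t.
  by have [] := fCb t.
move: lo hi; rewrite !integral_addC// !integral_Csub//.
rewrite -(IE nu) -(IE (AG p n)) -!EFinB -!EFinD !lee_fin /= => lo hi.
by rewrite ler_distl; lra.
Unshelve. all: by end_near. Qed.
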